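(* For the $k$-hypergraph pricing problem (under either the UDP or the SMP buying rule) and any constant $\delta>0$, there is an algorithm that gives an approximation ratio of $O(n^{\delta})$ and runs in time $O\big(2^{(\log m)^{\frac{1-\delta}{\delta}}\log\log m}\,\mathrm{poly}(n,m)\big)$, where $n$ is the number of items and $m$ the number of consumers.
   Context: An instance of the $k$-hypergraph pricing problem consists of a set $\mathcal{I}$ of $n$ items and a set $\mathcal{C}$ of $m$ consumers; each consumer $c$ has a budget $B_c\ge0$ and a set $S_c\subseteq\mathcal{I}$ with $|S_c|\le k$. A price function is $p:\mathcal{I}\to\mathbb{R}_{\ge0}\cup\{\infty\}$. Under UDP, consumer $c$ pays $\min_{i\in S_c}p(i)$ if this is at most $B_c$ and $0$ otherwise; under SMP, $c$ pays $\sum_{i\in S_c}p(i)$ if this is at most $B_c$ and $0$ otherwise. The revenue is the total payment and $\mathrm{OPT}$ is the maximum revenue; an approximation ratio $\rho$ means the returned revenue is at least $\mathrm{OPT}/\rho$. *)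

(* Defs.v *)
From HB Require Import structures.
From mathcomp Require Import all_boot all_order all_algebra.
From mathcomp Require Import all_classical all_reals all_analysis.

Set Implicit Arguments.
Unset Strict Implicit.
Unset Printing Implicit Defensive.

Import Order.TTheory GRing.Theory Num.Theory.

Local Open Scope classical_set_scope.
Local Open Scope ring_scope.

Record instance (R : realType) (k n m : nat) := Instance {
  budget : 'I_m -> R;
  bundle : 'I_m -> {set 'I_n};
  budget_ge0 : forall c, 0 <= budget c;
  bundle_card : forall c, (#|bundle c| <= k)%N
}.

Inductive buying_rule := UDP | SMP.

Definition is_price (R : realType) (n : nat) (p : 'I_n -> \bar R) : Prop :=
  forall i, (0 <= p i)%E.

(* The minimum over an empty bundle is +oo: such a consumer buys nothing. *)
Definition asked (R : realType) (r : buying_rule) (n : nat)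
    (p : 'I_n -> \bar R) (S : {set 'I_n}) : \bar R :=
  match r with
  | UDP => \big[Order.min/+oo%E]_(i in S) p i
  | SMP => (\sum_(i in S) p i)%E
  end.

Definition payment (R : realType) (r : buying_rule) (k n m : nat)
    (I : instance R k n m) (p : 'I_n -> \bar R) (c : 'I_m) : \bar R :=
  if (asked r p (bundle I c) <= (budget I c)%:E)%E
  then asked r p (bundle I c) else 0%E.

Definition revenue (R : realType) (r : buying_rule) (k n m : nat)
    (I : instance R k n m) (p : 'I_n -> \bar R) : \bar R :=
  (\sum_(c < m) payment r I p c)%E.

(* The supremum is attained: each payment is an upper semicontinuous function
   of the price vector, which ranges over the compact space [0, +oo]^n. *)
Definition OPT (R : realType) (r : buying_rule) (k n m : nat)
    (I : instance R k n m) : \bar R :=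
  ereal_sup [set revenue r I p | p in [set p | is_price p]].

Definition approximates (R : realType) (r : buying_rule) (k n m : nat)
    (I : instance R k n m) (p : 'I_n -> \bar R) (rho : R) : Prop :=
  (rho^-1%:E * OPT r I <= revenue r I p)%E.

(* Model of computation: a real RAM with structured control flow.  Its memory
   consists of arrays of natural numbers and arrays of reals; array names are
   fixed in the program, indices are computed.  Natural numbers can be added,
   (truncatedly) subtracted and compared; there is no unit-cost multiplication
   of naturals, so they have at most linearly many bits in the running time.
   Reals can be added, subtracted, multiplied, divided (x / 0 = 0) and
   compared; there is no rounding of reals to integers.  The only real
   literals are integers, so a program carries no real-valued advice. *)
Inductive nexp :=
  | NLit of nat
  | NGet of nat & nexp
  | NAdd of nexp & nexp
  | NSub of nexp & nexp.

Inductive rexp :=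
  | RLit of int
  | RGet of nat & nexp
  | RAdd of rexp & rexp
  | RSub of rexp & rexp
  | RMul of rexp & rexp
  | RDiv of rexp & rexp.

Inductive bexp :=
  | BNle of nexp & nexp
  | BRle of rexp & rexp
  | BNot of bexp
  | BAnd of bexp & bexp.

Inductive cmd :=
  | Skip
  | NSet of nat & nexp & nexp
  | RSet of nat & nexp & rexp
  | Seq of cmd & cmd
  | If of bexp & cmd & cmd
  | While of bexp & cmd.

(* [nmem s a i] and [rmem s a i] are the [i]-th cells of the arrays named [a] *)
Record state (R : realType) := State {
  nmem : nat -> nat -> nat;
  rmem : nat -> nat -> R
}.

Definition upd (T : Type) (mem : nat -> nat -> T) (a i : nat) (x : T) :
    nat -> nat -> T :=
  fun b j => if (b == a) && (j == i) then x else mem b j.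

Fixpoint neval (R : realType) (s : state R) (e : nexp) : nat :=
  match e with
  | NLit k => k
  | NGet a e1 => nmem s a (neval s e1)
  | NAdd e1 e2 => (neval s e1 + neval s e2)%N
  | NSub e1 e2 => (neval s e1 - neval s e2)%N
  end.

Fixpoint reval (R : realType) (s : state R) (e : rexp) : R :=
  match e with
  | RLit z => z%:~R
  | RGet a e1 => rmem s a (neval s e1)
  | RAdd e1 e2 => reval s e1 + reval s e2
  | RSub e1 e2 => reval s e1 - reval s e2
  | RMul e1 e2 => reval s e1 * reval s e2
  | RDiv e1 e2 => reval s e1 / reval s e2
  end.

Fixpoint beval (R : realType) (s : state R) (b : bexp) : bool :=
  match b with
  | BNle e1 e2 => (neval s e1 <= neval s e2)%N
  | BRle e1 e2 => reval s e1 <= reval s e2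
  | BNot b1 => ~~ beval s b1
  | BAnd b1 b2 => beval s b1 && beval s b2
  end.

(* [exec P s t s']: from memory [s], [P] halts in [t] steps with memory [s'].
   Every assignment and every test is one step; the expressions occurring in a
   program have a fixed size, so charging each of their operations would only
   change [t] by a constant factor. *)
Inductive exec (R : realType) : cmd -> state R -> nat -> state R -> Prop :=
  | exec_skip s : exec Skip s 1 s
  | exec_nset a i e s :
      exec (NSet a i e) s 1
        (State (upd (nmem s) a (neval s i) (neval s e)) (rmem s))
  | exec_rset a i e s :
      exec (RSet a i e) s 1
        (State (nmem s) (upd (rmem s) a (neval s i) (reval s e)))
  | exec_seq P Q s t s1 u s2 :
      exec P s t s1 -> exec Q s1 u s2 -> exec (Seq P Q) s (t + u) s2
  | exec_if b P Q s t s1 :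
      exec (if beval s b then P else Q) s t s1 -> exec (If b P Q) s t.+1 s1
  | exec_while_done b P s :
      ~~ beval s b -> exec (While b P) s 1 s
  | exec_while_step b P s t s1 u s2 :
      beval s b -> exec P s t s1 -> exec (While b P) s1 u s2 ->
      exec (While b P) s (t + u).+1 s2.

(* Input convention: the sizes n and m, the m x n incidence matrix of the
   bundles stored row by row, the constant delta, and the budgets.  All the
   other cells are initially 0. *)
Definition init (R : realType) (delta : R) (k n m : nat)
    (I : instance R k n m) : state R :=
  {| nmem := fun a j =>
       match a, j with
       | 0%N, 0%N => n
       | 1%N, 0%N => m
       | 2%N, _ => [exists c : 'I_m, exists i : 'I_n,
                     (j == c * n + i)%N && (i \in bundle I c)] : nat
       | _, _ => 0%N
       end;
     rmem := fun a j =>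
       match a, j with
       | 0%N, 0%N => delta
       | 1%N, _ => if insub j is Some c then budget I c else 0
       | _, _ => 0
       end |}.

(* Output convention: the price of item i is rmem 2 i, or +oo if nmem 3 i is
   nonzero. *)
Definition output (R : realType) (n : nat) (s : state R) : 'I_n -> \bar R :=
  fun i => if nmem s 3 i == 0%N then (rmem s 2 i)%:E else +oo%E.

Definition log2 (R : realType) (x : R) : R := ln x / ln 2.

(* Since [ln 0 = 0], this is 1 for [m <= 1], where log log m is undefined. *)
Definition time_factor (R : realType) (delta : R) (m : nat) : R :=
  2 `^ (log2 m%:R `^ ((1 - delta) / delta) * log2 (log2 m%:R)).

Lemma exec_det (R : realType) (P : cmd) (s : state R) t1 s1 t2 s2 :
  exec P s t1 s1 -> exec P s t2 s2 -> t1 = t2 /\ s1 = s2.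
Proof.
move=> H; elim: H t2 s2 => {P s t1 s1}.
- by move=> s t2 s2 H; inversion H; subst.
- by move=> a i e s t2 s2 H; inversion H; subst.
- by move=> a i e s t2 s2 H; inversion H; subst.
- move=> P Q s t s1 u s2 _ IH1 _ IH2 t' s' H.
  inversion H as [| | | ? ? ? ? ? ? ? HP HQ | | |]; subst.
  by have [? ?] := IH1 _ _ HP; subst; have [-> ->] := IH2 _ _ HQ.
- move=> b P Q s t s1 _ IH t' s' H.
  inversion H as [| | | | ? ? ? ? ? ? HP | |]; subst.
  by have [-> ->] := IH _ _ HP.
- move=> b P s /negP nb t' s' H.
  by inversion H; subst.
- move=> b P s t s1 u s2 hb _ IH1 _ IH2 t' s' H.
  inversion H as [| | | | | ? ? ? nb | ? ? ? ? ? ? ? _ HP HW]; subst.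
    by rewrite hb in nb.
  by have [? ?] := IH1 _ _ HP; subst; have [-> ->] := IH2 _ _ HW.
Qed.

(* Main.v *)
Require Import Defs.
From HB Require Import structures.
From mathcomp Require Import all_boot all_order all_algebra.
From mathcomp Require Import all_classical all_reals all_analysis.
From mathcomp Require Import zify ring lra.

Import Order.TTheory GRing.Theory Num.Theory.

Local Open Scope ring_scope.

(* Let beta be the largest budget of a consumer with a nonempty bundle.  Rounding
   every price down to a price beta / 2^j, and discarding the prices that are
   too small, costs a factor 2 and an additive beta / 2.  After rounding, the
   uniform prices alone earn a 1 / O(Q) fraction of the total budget of the
   consumers with nonempty bundles, where Q = O(log (n + m)) is the number of
   price options.  On the other hand,
   the revenue is subadditive over a partition of the items: pricing one group
   of items at a time (the others are free under SMP and unaffordable under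
   UDP) loses at most the number of groups.

   The program computes K = 2^(floor (delta * floor (log2 n))), which is
   n^delta up to a constant factor, and tries the uniform prices.  If Q <= C K
   they are good enough.  Otherwise it splits the items into at most C K groups
   of g = ceil (n / (C K)) items and tries all (Q+1)^g price vectors on each
   group.  Then, C being large, n^delta <= log2 m, Q+1 <= (log2 m)^3 and, unless
   g <= 1, 3 g <= n^(1-delta) <= (log2 m)^((1-delta)/delta), so that (Q+1)^g is
   within the time factor. *)

(** * Rounding and grouping prices *)

Section Payments.
Context {R : realType}.
Implicit Types (r : buying_rule) (off b x : R) (S : nat -> bool) (p : nat -> R).

Definition combine r x y : R :=
  match r with UDP => Num.min x y | SMP => x + y end.

(** The recursion follows the item loop of the program, so that its value after [k] items can serve
    as a loop invariant there. *)
Fixpoint ask r off S p (k : nat) : R :=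
  if k is i.+1 then
    if S i then combine r (ask r off S p i) (p i) else ask r off S p i
  else off.

Definition pay r off S b p n : R :=
  if ask r off S p n <= b then ask r off S p n else 0.

Lemma eq_ask r off S p p' k :
  (forall i, (i < k)%N -> p i = p' i) -> ask r off S p k = ask r off S p' k.
Proof.
elim: k => //= k IH pp'.
by rewrite pp' // IH // => i ik; apply: pp'; lia.
Qed.

Lemma ask_UDP_le_off off S p k : ask UDP off S p k <= off.
Proof. by elim: k => //= k IH; case: ifP => //= _; rewrite ge_min IH. Qed.

Lemma ask_UDP_le off S p k i : (i < k)%N -> S i -> ask UDP off S p k <= p i.
Proof.
elim: k => //= k IH; rewrite ltnS leq_eqVlt => /orP[/eqP->|ik] Si.
  by rewrite Si /= ge_min lexx orbT.
by case: ifP => _ /=; rewrite ?ge_min IH.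
Qed.

Lemma ask_UDP_attained off S p k :
  ask UDP off S p k = off \/
  exists i, [/\ (i < k)%N, S i & ask UDP off S p k = p i].
Proof.
elim: k => /= [|k IH]; first by left.
case: ifP => [Sk|_] /=.
  rewrite /Num.min; case: ifP => _; last by right; exists k.
  by case: IH => [->|[i [ik Si e]]]; [left|right; exists i; split; rewrite ?leqW].
by case: IH => [->|[i [ik Si e]]]; [left|right; exists i; split; rewrite ?leqW].
Qed.

Lemma ask_SMP off S p k : ask SMP off S p k = off + \sum_(0 <= i < k | S i) p i.
Proof.
elim: k => /= [|k ->]; first by rewrite big_geq // addr0.
by rewrite [in RHS]big_mkcond big_nat_recr //= -big_mkcond /=; case: ifP;
  rewrite ?addr0 ?addrA.
Qed.

Lemma ask_ge0 r off S p n :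
  0 <= off -> (forall i, (i < n)%N -> 0 <= p i) -> 0 <= ask r off S p n.
Proof.
move=> off0; elim: n => //= n IH p0.
have a0 : 0 <= ask r off S p n by apply: IH => i ?; apply: p0; lia.
case: ifP => // _; case: (r) a0 => /= a0; last by rewrite addr_ge0 // p0.
by rewrite le_min a0 p0.
Qed.

Lemma pay_ge0 r off S b p n :
  0 <= off -> (forall i, (i < n)%N -> 0 <= p i) -> 0 <= pay r off S b p n.
Proof. by move=> ? ?; rewrite /pay; case: ifP => // _; apply: ask_ge0. Qed.

Lemma pay_le r off S b p n : 0 <= b -> pay r off S b p n <= b.
Proof. by rewrite /pay; case: ifP. Qed.

(* Under UDP the price W exceeds all budgets, so that it works as [+oo]. *)
Definition off_price r (W : R) : R := match r with UDP => W | SMP => 0 end.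

Lemma pay_empty r W S b p n :
  b < W -> (forall i, (i < n)%N -> ~~ S i) -> pay r (off_price r W) S b p n = 0.
Proof.
move=> bW S0; suff e : ask r (off_price r W) S p n = off_price r W.
  rewrite /pay e; case: r {e} => /=; last by case: ifP.
  by rewrite leNgt bW.
elim: n S0 => //= n IH S0; rewrite (negbTE (S0 n _)) // IH // => i ?.
by apply: S0; lia.
Qed.

(** Index 0 stands for an item left out of the pricing: with [off_price] it is unaffordable under
    UDP and free under SMP. The later indices descend a geometric scale from [beta]. *)
Definition price_option off (beta : R) (j : nat) : R :=
  if j is i.+1 then beta / 2 ^+ i else off.

Lemma round_price off beta (q : nat) x : 0 <= beta ->
  exists j, (j <= q.+1)%N /\
    ((j = 0%N /\ (x < beta / 2 ^+ q \/ beta < x)) \/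
     [/\ (0 < j)%N, price_option off beta j <= x &
         x <= 2 * price_option off beta j]).
Proof.
move=> b0.
have [xb|bx] := leP x beta; last by exists 0%N; split => //; left; split; auto.
have [tx|xt] := leP (beta / 2 ^+ q) x; last first.
  by exists 0%N; split => //; left; split; auto.
have ex : exists j, beta / 2 ^+ j <= x by exists q.
(* Minimality of [j] puts [x] below the preceding option, which is twice the chosen one. *)
case: (ex_minnP ex) => j jx jmin; exists j.+1; split.
  by rewrite ltnS; apply: jmin.
right; split => //=.
case: j jx jmin => [|j] jx jmin; first by rewrite expr0 divr1; lra.
have : ~~ (beta / 2 ^+ j <= x) by apply/negP => /jmin; lia.
rewrite -ltNge => /ltW /le_trans; apply.
by rewrite exprS invfM !mulrA; have -> : 2 * beta / 2 = beta by field.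
Qed.

Lemma price_option_le off beta j : 0 <= beta -> price_option off beta j.+1 <= beta.
Proof.
move=> b0 /=; rewrite ler_pdivrMr ?exprn_gt0 // ler_peMr //.
by apply: exprn_ege1; rewrite ler1n.
Qed.

Lemma price_option_ge0 r (W beta : R) j :
  0 <= W -> 0 <= beta -> 0 <= price_option (off_price r W) beta j.
Proof.
case: j => [|j] W0 b0 /=; first by case: r.
by rewrite divr_ge0 // exprn_ge0.
Qed.

(** * Payments of a single consumer *)

Section OneConsumer.
Variables (r : buying_rule) (W beta : R) (q n : nat) (S : nat -> bool) (b : R).
Hypotheses (beta0 : 0 <= beta) (b0 : 0 <= b) (bW : b < W).

Let off := off_price r W.
Let opt := price_option off beta.
Let tau := beta / 2 ^+ q.

Let tau0 : 0 <= tau. Proof. by rewrite divr_ge0 // exprn_ge0. Qed.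
Let W0 : 0 <= W. Proof. by apply: le_trans b0 (ltW bW). Qed.
Let opt0 j : 0 <= opt j. Proof. exact: price_option_ge0. Qed.

(** Under UDP round the budget itself down to an option; under SMP round the budget divided by the
    size of the bundle. The consumer can afford the resulting uniform price and spends at least half
    of [b], unless the rounded quantity lies below the scale. *)
Lemma uniform_price_pay i0 : b <= beta -> (i0 < n)%N -> S i0 ->
  b <= n%:R * tau \/
  exists2 j, (j <= q)%N & b <= 2 * pay r off S b (fun=> opt j.+1) n.
Proof.
move=> bbeta i0n Si0.
case: r @off @opt opt0 => /= opt0'.
  have [[|j] [jq]] := round_price W beta q b beta0.
    case=> [[_ [bt|bb]]|[]//]; last by lra.
    left; apply: le_trans (ltW bt) _; rewrite ler_peMl // ler1n; lia.
  case=> [[]//|[_ bj jb]]; right; exists j; first exact: jq.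
  suff e : ask UDP W S (fun=> price_option W beta j.+1) n = price_option W beta j.+1.
    by rewrite /pay e bj.
  have := ask_UDP_le W S (fun=> price_option W beta j.+1) _ _ i0n Si0.
  case: (ask_UDP_attained W S (fun=> price_option W beta j.+1) n) => [->|[i [_ _ ->]]] //.
  by move=> /le_trans /(_ bj); rewrite leNgt bW.
(* Under SMP, [w] is the size of the bundle and [b / w] the uniform price that exhausts the
   budget. *)
pose w : R := \sum_(0 <= i < n | S i) 1.
have w1 : 1 <= w.
  rewrite /w big_mkcond (bigD1_seq i0) ?iota_uniq ?mem_index_iota //= Si0.
  by rewrite lerDl; apply: sumr_ge0 => i _; case: ifP.
have wn : w <= n%:R.
  rewrite /w big_mkcond /=; apply: (@le_trans _ _ (\sum_(0 <= i < n) 1)).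
    by apply: ler_sum => i _; case: ifP.
  by rewrite big_const_nat subn0 iter_addr_0.
have w0 : 0 < w by lra.
have ub : b / w <= b by rewrite ler_pdivrMr // ler_peMr.
have bw : b = w * (b / w) by field; rewrite gt_eqF.
have [[|j] [jq]] := round_price 0 beta q (b / w) beta0.
  case=> [[_ [bt|bb]]|[]//]; last by lra.
  left; rewrite bw; apply: (@le_trans _ _ (w * tau)); first by rewrite ler_pM2l // ltW.
  by rewrite ler_wpM2r.
case=> [[]//|[_ bj jb]]; right; exists j; first exact: jq.
have e : ask SMP 0 S (fun=> price_option 0 beta j.+1) n = w * price_option 0 beta j.+1.
  by rewrite ask_SMP add0r /w mulr_suml; apply: eq_bigr => i _; rewrite mul1r.
set o := price_option 0 beta j.+1 in bj jb e *.
have ob : w * o <= b by rewrite [leRHS]bw ler_pM2l.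
by rewrite /pay e ob [leLHS]bw [leRHS]mulrCA ler_pM2l.
Qed.

Variables (G : nat) (group d : nat -> nat) (y : nat -> R).
Hypotheses (y0 : forall i, 0 <= y i) (groupG : forall i, (i < n)%N -> (group i < G)%N).
Hypothesis dP : forall i, 
    (d i = 0%N /\ (y i < tau \/ beta < y i)) \/
     [/\ (0 < d i)%N, opt (d i) <= y i & y i <= 2 * opt (d i)].
Hypothesis bbeta : forall i, (i < n)%N -> S i -> b <= beta.

(** Option 0 outside group [t] keeps the other items from competing under UDP and from adding to the
    bundle price under SMP. *)
Let part (t i : nat) := opt (if group i == t then d i else 0%N).

Let part_pay0 t : 0 <= pay r off S b (part t) n.
Proof. by apply: pay_ge0 => [|i _]; [case: r @off|exact: opt0]. Qed.

Let part_pay_le t : (t < G)%N ->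
  2 * pay r off S b (part t) n <=
  2 * \sum_(0 <= t < G) pay r off S b (part t) n + n%:R * tau.
Proof.
move=> tG; rewrite (bigD1_seq t) ?iota_uniq ?mem_index_iota ?tG //=.
by rewrite mulrDr -addrA lerDl addr_ge0 ?mulr_ge0 ?sumr_ge0.
Qed.

(** Under UDP the group of the purchased item alone recovers half of the payment. Under SMP every
    group stays affordable and the groups add up to at least half of it. In both cases the prices
    below [tau] account for the term [n * tau]. *)
Lemma grouped_price_pay :
  pay r off S b y n <= 2 * \sum_(0 <= t < G) pay r off S b (part t) n + n%:R * tau.
Proof.
have rhs0 : 0 <= 2 * \sum_(0 <= t < G) pay r off S b (part t) n + n%:R * tau.
  by rewrite addr_ge0 ?mulr_ge0 ?sumr_ge0.
rewrite {1}/pay; case: ifP => // askb.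
case er : r askb.
  have offW : off = W by rewrite /off er.
  have [->|[i [ik Si e]]] := ask_UDP_attained off S y n.
    by rewrite offW leNgt bW.
  rewrite e => yb.
  have bb := bbeta i ik Si.
  have [[_ [yt|yb2]]|[di oy yo]] := dP i; last 2 first.
  - by move: (le_lt_trans (le_trans yb bb) yb2); rewrite ltxx.
  - apply: le_trans (_ : 2 * pay r off S b (part (group i)) n <= _); last first.
      by have := part_pay_le _ (groupG i ik); rewrite er.
    have ai : part (group i) i = opt (d i) by rewrite /part eqxx.
    have := ask_UDP_le off S (part (group i)) _ _ ik Si; rewrite ai => le1.
    have yW : y i <= 2 * W by move: yb bW W0; lra.
    rewrite /pay er (le_trans le1 (le_trans oy yb)).
    (* The price asked after rounding is [W] or the option of some [i'] in the bundle. Since [y i]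
       is minimal over the bundle and rounding at most halves, twice that price is at least [y i] in
       every case. *)
    have [->|[i' [ik' Si' ->]]] := ask_UDP_attained off S (part (group i)) n.
      by rewrite offW.
    have yii : y i <= y i' by rewrite -e; apply: ask_UDP_le.
    rewrite /part; case: ifP => [_|_]; last by rewrite /= -/off offW.
    have [[-> _]|[_ _ yo']] := dP i'; first by rewrite /= -/off offW.
    exact: le_trans yii yo'.
  apply: (@le_trans _ _ (n%:R * tau)); last by rewrite -er lerDr mulr_ge0 ?sumr_ge0.
  by apply: le_trans (ltW yt) _; rewrite ler_peMl // ler1n (leq_ltn_trans _ ik).
have off_0 : off = 0 by rewrite /off er.
rewrite ask_SMP off_0 add0r => yb.
have yib i : (i < n)%N -> S i -> y i <= b.
  move=> ik Si; apply: le_trans yb.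
  rewrite big_mkcond (bigD1_seq i) ?iota_uniq ?mem_index_iota //= Si.
  by rewrite lerDl sumr_ge0 // => ? _; case: ifP.
have oy i : (i < n)%N -> S i -> opt (d i) <= y i.
  by move=> ik Si; have [[-> _]|[]] := dP i => //; rewrite /opt /= off_0.
have party t i : (i < n)%N -> S i -> part t i <= y i.
  move=> ik Si; rewrite /part; case: ifP => [_|_]; first exact: oy.
  by rewrite /opt /= off_0.
(* Rounding down and freeing items only lowers the bundle price, so a bundle bought at [y] is bought
   at every [part t]. *)
have pp t : pay SMP 0 S b (part t) n = \sum_(0 <= i < n | S i) part t i.
  have le : \sum_(0 <= i < n | S i) part t i <= b.
    apply: le_trans yb; rewrite big_nat_cond [leRHS]big_nat_cond.
    by apply: ler_sum => i /andP[/andP[_ ik] Si]; apply: party.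
  by rewrite /pay ask_SMP add0r le.
rewrite ?er ?off_0; under [in leRHS]eq_bigr => t _ do rewrite pp.
rewrite exchange_big mulr_sumr /=.
(* The comparison is made item by item: [y i] is either below [tau] or at most twice its rounded
   price, which appears in the part of its own group. *)
apply: (@le_trans _ _ (\sum_(0 <= i < n | S i) (2 * (\sum_(0 <= t < G) part t i) + tau))).
  rewrite big_nat_cond [leRHS]big_nat_cond; apply: ler_sum => i /andP[/andP[_ ik] Si].
  have po : opt (d i) <= \sum_(0 <= t < G) part t i.
    rewrite (bigD1_seq (group i)) ?iota_uniq ?mem_index_iota ?groupG //=.
    rewrite {1}/part eqxx lerDl; apply: sumr_ge0 => t _; exact: opt0.
  have [[_ [yt|yb2]]|[_ _ yo]] := dP i.
  - apply: le_trans (ltW yt) _; rewrite lerDr mulr_ge0 // sumr_ge0 // => t _.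
    exact: opt0.
  - have := le_lt_trans (le_trans (yib i ik Si) (bbeta i ik Si)) yb2.
    by rewrite ltxx.
  - by apply: le_trans yo _; rewrite -[leLHS]addr0 lerD // ler_pM2l.
rewrite big_split /= lerD2l big_mkcond /=.
apply: (@le_trans _ _ (\sum_(0 <= i < n) tau)).
  by apply: ler_sum => i _; case: ifP.
by rewrite big_const_nat subn0 iter_addr_0 mulr_natl.
Qed.

End OneConsumer.

Definition total_pay r off n m (inc : nat -> nat -> bool) (B : nat -> R) p :=
  \sum_(0 <= c < m) pay r off (inc c) (B c) p n.

(** * Total revenue bounded by the best candidate *)

Section Market.
Variables (r : buying_rule) (W beta : R) (q n m : nat).
Variables (inc : nat -> nat -> bool) (B : nat -> R).
Hypotheses (beta0 : 0 <= beta) (B0 : forall c, 0 <= B c).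
Hypothesis BW : forall c, (c < m)%N -> B c < W.
Hypothesis W0 : 0 <= W.
Hypothesis B_beta : forall c i, (c < m)%N -> (i < n)%N -> inc c i -> B c <= beta.
Hypothesis beta_B : beta = 0 \/
  exists c i, [/\ (c < m)%N, (i < n)%N, inc c i & B c = beta].
Hypothesis nm_q : (2 * (n * m) <= 2 ^ q)%N.

Let off := off_price r W.
Let opt := price_option off beta.
Let tau := beta / 2 ^+ q.
Let opt0 j : 0 <= opt j. Proof. exact: price_option_ge0. Qed.

Local Notation income := (total_pay r off n m inc B).

Lemma total_pay_ge0 p : (forall i, (i < n)%N -> 0 <= p i) -> 0 <= income p.
Proof.
by move=> p0; apply: sumr_ge0 => c _; apply: pay_ge0 => //; rewrite /off; case: r.
Qed.

Variable M : R.
Hypothesis M0 : 0 <= M.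
Hypothesis M_uniform : forall j, (j <= q)%N -> income (fun=> opt j.+1) <= M.

(** The scale is long enough, by [nm_q], for the loss of [n * tau] per consumer to total at most
    half the largest relevant budget. *)
Let tau_small : m%:R * (n%:R * tau) <= beta / 2.
Proof.
rewrite mulrA -natrM mulrA ler_pdivrMr ?exprn_gt0 //.
have : ((2 * (n * m))%:R <= (2 ^ q)%:R :> R) by rewrite ler_nat.
by rewrite natrM natrX mulnC => h; have := ler_wpM2l beta0 h; lra.
Qed.

Let pay_le_M c j : (c < m)%N -> (j <= q)%N ->
  pay r off (inc c) (B c) (fun=> opt j.+1) n <= M.
Proof.
move=> cm jq; apply: le_trans (M_uniform j jq).
rewrite /total_pay (bigD1_seq c) ?iota_uniq ?mem_index_iota //= lerDl.
apply: sumr_ge0 => c' _; apply: pay_ge0; first by rewrite /off; case: r.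
by move=> i _; exact: (opt0 j.+1).
Qed.

(** Apply [uniform_price_pay] to a consumer with budget [beta]: a uniform price extracts half of it,
    or else [beta <= n * tau <= beta / 2], which forces [beta] to vanish. *)
Let beta_le : beta <= 2 * M.
Proof.
have [->|[c [i [cm ilt ci Bc]]]] := beta_B; first by rewrite mulr_ge0.
have bb : B c <= beta by rewrite Bc.
have [|[j jq jb]] := uniform_price_pay r W beta q n (inc c) (B c) beta0 (B0 c) (BW c cm) i bb ilt ci.
  rewrite Bc -/tau => bt.
  have : n%:R * tau <= m%:R * (n%:R * tau).
    rewrite ler_peMl ?ler1n ?(leq_ltn_trans _ cm) //.
    by rewrite mulr_ge0 // divr_ge0 // exprn_ge0.
  move: tau_small M0; lra.
by rewrite -Bc; apply: le_trans jb _; rewrite ler_pM2l //; exact: pay_le_M.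
Qed.

(** Summing over consumers gives [2 * G * M] plus an additive loss of at most [beta / 2], which is
    at most [M]. It is applied both to the uniform prices and to the groups of items. *)
Lemma total_pay_family_le (G : nat) (cand : nat -> nat -> R) (y : nat -> R) :
  (forall c, (c < m)%N -> pay r off (inc c) (B c) y n <=
     2 * (\sum_(0 <= t < G) pay r off (inc c) (B c) (cand t) n) + n%:R * tau) ->
  (forall t, (t < G)%N -> income (cand t) <= M) ->
  income y <= (2 * G + 1)%:R * M.
Proof.
move=> payG candM.
apply: (@le_trans _ _ (\sum_(0 <= c < m)
  (2 * (\sum_(0 <= t < G) pay r off (inc c) (B c) (cand t) n) + n%:R * tau))).
  rewrite /total_pay big_nat [leRHS]big_nat; apply: ler_sum => c /andP[_]; exact: payG.
rewrite big_split /= -mulr_sumr exchange_big /= big_const_nat subn0 iter_addr_0.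
have GM : \sum_(0 <= t < G) income (cand t) <= G%:R * M.
  apply: (@le_trans _ _ (\sum_(0 <= t < G) M)).
    rewrite big_nat [leRHS]big_nat; apply: ler_sum => t /andP[_]; exact: candM.
  by rewrite big_const_nat subn0 iter_addr_0 mulr_natl.
have -> : (2 * G + 1)%:R * M = 2 * (G%:R * M) + M by rewrite natrD natrM; ring.
rewrite -[(n%:R * tau) *+ m]mulr_natl lerD // ?ler_pM2l //.
by move: tau_small beta_le; lra.
Qed.

(** The candidates are the [q + 1] uniform prices. Nobody pays more than the budget, and up to
    [n * tau] some uniform price collects half of it. *)
Lemma total_pay_uniform_le (y : nat -> R) : (forall i, 0 <= y i) ->
  income y <= (2 * q.+1 + 1)%:R * M.
Proof.
move=> y0; apply: (total_pay_family_le _ (fun j (_ : nat) => opt j.+1)); last first.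
  by move=> j jq; apply: M_uniform.
move=> c cm.
have pc0 p : (forall i, 0 <= p i) -> 0 <= pay r off (inc c) (B c) p n.
  by move=> p0; apply: pay_ge0 => //; rewrite /off; case: r.
have pj0 j : 0 <= pay r off (inc c) (B c) (fun=> opt j.+1) n.
  by apply: pc0 => i; exact: (opt0 j.+1).
have nt0 : 0 <= n%:R * tau by rewrite mulr_ge0 // divr_ge0 // exprn_ge0.
(* A consumer with an empty bundle may have a budget above [beta], but pays nothing. *)
have [ci|cN] := pselect (exists2 i, (i < n)%N & inc c i); last first.
  rewrite pay_empty; first by rewrite addr_ge0 ?mulr_ge0 ?sumr_ge0.
    exact: BW.
  by move=> i ilt; apply/negP => ci; apply: cN; exists i.
case: ci => i ilt ci.
have [|[j jq]] := uniform_price_pay r W beta q n (inc c) (B c) beta0 (B0 c)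
  (BW c cm) i (B_beta c i cm ilt ci) ilt ci.
  move=> /(le_trans (pay_le _ _ _ _ _ _ (B0 c))) /le_trans; apply.
  by rewrite lerDr mulr_ge0 ?sumr_ge0.
move=> /(le_trans (pay_le _ _ _ _ _ _ (B0 c))) /le_trans; apply.
rewrite (bigD1_seq j) ?iota_uniq ?mem_index_iota //=.
rewrite mulrDr -addrA lerDl addr_ge0 ?mulr_ge0 ?sumr_ge0 // => ? _.
exact: pj0.
Qed.

(** Groups are blocks of [g] consecutive items, and [f] is indexed by the offset inside the block,
    as in the enumeration done by the program. *)
Lemma total_pay_grouped_le (g G : nat) (y : nat -> R) : (forall i, 0 <= y i) ->
  (0 < g)%N -> (forall i, (i < n)%N -> (i %/ g < G)%N) ->
  (forall t (f : nat -> nat), (t < G)%N -> (forall k, (f k <= q.+1)%N) ->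
    income (fun i => opt (if (i %/ g == t)%N then f (i - t * g)%N else 0%N)) <= M) ->
  income y <= (2 * G + 1)%:R * M.
Proof.
move=> y0 g0 gG MG.
have /choice[d dP] := fun i => round_price off beta q (y i) beta0.
apply: (total_pay_family_le _ (fun t i => opt (if (i %/ g == t)%N then d i else 0%N))).
  move=> c cm; apply: grouped_price_pay => //.
  - exact: BW.
  - by move=> i; have [_] := dP i.
  - by move=> i ilt ci; apply: B_beta ci.
move=> t tG.
have := MG t (fun k => d (t * g + k)%N) tG (fun k => (dP _).1).
rewrite (_ : (fun i => _) = (fun i => opt (if (i %/ g == t)%N then d i else 0%N))) //.
apply: funext => i; case: eqP => // <-; congr (opt (d _)).
by rewrite subnKC // leq_trunc_div.
Qed.

End Market.

End Payments.

(** * Running time logic *)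

Section ProgramLogic.
Context {R : realType}.
Implicit Types (P : cmd) (s : state R).

Fixpoint nwrites P : seq nat :=
  match P with
  | NSet a _ _ => [:: a]
  | Seq P Q | If _ P Q => nwrites P ++ nwrites Q
  | While _ P => nwrites P
  | _ => [::]
  end.

Fixpoint rwrites P : seq nat :=
  match P with
  | RSet a _ _ => [:: a]
  | Seq P Q | If _ P Q => rwrites P ++ rwrites Q
  | While _ P => rwrites P
  | _ => [::]
  end.

(** Only whole arrays are tracked, so preservation of an array is decided by computation on the text
    of [P]. *)
Definition frame P s s' :=
  (forall a, a \notin nwrites P -> nmem s' a = nmem s a) /\
  (forall a, a \notin rwrites P -> rmem s' a = rmem s a).

Lemma upd_other T (mem : nat -> nat -> T) a i x b :
  b != a -> upd mem a i x b = mem b.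
Proof. by move=> /negbTE ba; rewrite /upd ba. Qed.

Lemma frame_trans P s1 s2 s3 : frame P s1 s2 -> frame P s2 s3 -> frame P s1 s3.
Proof.
by move=> [n1 r1] [n2 r2]; split=> a aP; rewrite ?n2 ?r2 ?n1 ?r1.
Qed.

Lemma frameW P Q s s' : {subset nwrites P <= nwrites Q} ->
  {subset rwrites P <= rwrites Q} -> frame P s s' -> frame Q s s'.
Proof.
move=> nPQ rPQ [fn fr]; split=> a aQ; [apply: fn|apply: fr].
  by apply: contra aQ => /nPQ.
by apply: contra aQ => /rPQ.
Qed.

Lemma exec_frame P s t s' : exec P s t s' -> frame P s s'.
Proof.
have subl (T : eqType) (u v : seq T) : {subset u <= u ++ v}.
  by move=> x; rewrite mem_cat => ->.
have subr (T : eqType) (u v : seq T) : {subset v <= u ++ v}.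
  by move=> x; rewrite mem_cat => ->; rewrite orbT.
elim=> {P s t s'} //=.
- by move=> a i e s; split=> // b; rewrite inE; exact: upd_other.
- by move=> a i e s; split=> // b; rewrite inE; exact: upd_other.
- move=> P Q s t s1 u s2 _ IH1 _ IH2.
  by apply: frame_trans (frameW _ _ _ _ _ _ IH1) (frameW _ _ _ _ _ _ IH2);
    [exact: subl | exact: subl | exact: subr | exact: subr].
- move=> b P Q s t s1 _; case: (beval s b) => IH.
    by apply: frameW IH; exact: subl.
  by apply: frameW IH; exact: subr.
- by move=> b P s t s1 u s2 _ _ IH1 _ IH2; apply: frame_trans IH1 IH2.
Qed.

Arguments exec_frame {P s t s'}.

(** A total-correctness triple with an upper bound on the time, so that branches of different cost
    share one bound. *)
Definition runs P s (T : nat) (post : state R -> Prop) :=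
  exists t s', [/\ exec P s t s', (t <= T)%N & post s'].

Lemma runsW P s (T T' : nat) (post post' : state R -> Prop) :
  runs P s T post -> (T <= T')%N ->
  (forall s', frame P s s' -> post s' -> post' s') -> runs P s T' post'.
Proof.
move=> [t [s' [e tT ps']]] TT' pp'; exists t, s'; split => //.
  exact: leq_trans TT'.
by apply: pp' ps'; apply: exec_frame e.
Qed.

Arguments runsW {P s T T' post post'}.

Lemma runs_le (T : nat) P s (T' : nat) (post : state R -> Prop) :
  (T <= T')%N -> runs P s T post -> runs P s T' post.
Proof. by move=> TT' rT; apply: runsW rT TT' _. Qed.

Lemma runs_skip s (post : state R -> Prop) : post s -> runs Skip s 1 post.
Proof. by exists 1%N, s; split => //; constructor. Qed.

Lemma runs_nset a i e s (post : state R -> Prop) :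
  post (State (upd (nmem s) a (neval s i) (neval s e)) (rmem s)) ->
  runs (NSet a i e) s 1 post.
Proof. by move=> ps; eexists 1%N, _; split; [constructor| |exact: ps]. Qed.

Lemma runs_rset a i e s (post : state R -> Prop) :
  post (State (nmem s) (upd (rmem s) a (neval s i) (reval s e))) ->
  runs (RSet a i e) s 1 post.
Proof. by move=> ps; eexists 1%N, _; split; [constructor| |exact: ps]. Qed.

Lemma runs_seq P Q s (T U : nat) (post : state R -> Prop) :
  runs P s T (fun s1 => runs Q s1 U post) -> runs (Seq P Q) s (T + U) post.
Proof.
move=> [t [s1 [e1 tT [u [s2 [e2 uU ps2]]]]]]; exists (t + u)%N, s2.
by split; [econstructor; eassumption|exact: leq_add|].
Qed.

Lemma runs_if b P Q s (T : nat) (post : state R -> Prop) :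
  runs (if beval s b then P else Q) s T post -> runs (If b P Q) s T.+1 post.
Proof.
by move=> [t [s1 [e tT ps]]]; exists t.+1, s1; split => //; constructor.
Qed.

(** The invariant is indexed by the number of completed iterations. A true test must imply [k < N],
    which yields termination; the induction is on the [f = N - k] iterations left. Each iteration
    costs the body and a test, and one last test fails. *)
Lemma runs_while b P (T N : nat) (inv : nat -> state R -> Prop) s0 :
  inv 0%N s0 ->
  (forall k s, frame P s0 s -> inv k s -> beval s b ->
    (k < N)%N /\ runs P s T (inv k.+1)) ->
  runs (While b P) s0 (N * T.+1).+1
    (fun s => exists k, [/\ (k <= N)%N, inv k s & ~~ beval s b]).
Proof.
move=> inv0 step.
suff loop f k s : (f + k = N)%N -> frame P s0 s -> inv k s ->
    runs (While b P) s (f * T.+1).+1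
      (fun s => exists k, [/\ (k <= N)%N, inv k s & ~~ beval s b]).
  by apply: (loop N 0%N); rewrite ?addn0.
elim: f k s => [|f IH] k s fkN fs invk.
  case: (boolP (beval s b)) => sb.
    by have [] := step k s fs invk sb; rewrite -fkN add0n ltnn.
  exists 1%N, s; split => //; first by constructor.
  by exists k; split => //; rewrite -fkN.
case: (boolP (beval s b)) => sb; last first.
  exists 1%N, s; split => //; first by constructor.
  by exists k; split => //; rewrite -fkN leq_addl.
have [kN [t [s1 [e1 tT inv1]]]] := step k s fs invk sb.
have [||u [s2 [e2 uU ps2]]] := IH k.+1 s1 _ _ inv1.
- by rewrite addnS.
- by apply: frame_trans fs (exec_frame e1).
exists (t + u).+1, s2; split => //; first by apply: exec_while_step e1 e2.
by rewrite mulSn !ltnS; lia.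
Qed.

Definition nvar a := NGet a (NLit 0).
Definition rvar a := RGet a (NLit 0).

Definition for_ v e P :=
  Seq (NSet v (NLit 0) (NLit 0))
    (While (BNot (BNle e (nvar v)))
      (Seq P (NSet v (NLit 0) (NAdd (nvar v) (NLit 1))))).

Definition setn s a x := State (upd (nmem s) a 0 x) (rmem s).

(** The overhead of 2 per iteration is the test and the increment. The bound [e] may be re-evaluated
    each time because it keeps its value along the frame of the loop. *)
Lemma runs_for v e P (T N : nat) (inv : nat -> state R -> Prop) s0 :
  v \notin nwrites P ->
  (forall s, frame (for_ v e P) s0 s -> neval s e = N) ->
  inv 0%N (setn s0 v 0) ->
  (forall k s, (k < N)%N -> frame (for_ v e P) s0 s -> nmem s v 0 = k ->
    inv k s -> runs P s T (fun s' => inv k.+1 (setn s' v k.+1))) ->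
  runs (for_ v e P) s0 (N * T.+2).+2 (inv N).
Proof.
move=> vP eN inv0 step; rewrite -add1n; apply: runs_seq; apply: runs_nset => /=.
have vv s x : nmem (setn s v x) v 0 = x by rewrite /= /upd !eqxx.
have f0 s : frame (Seq P (NSet v (NLit 0) (NAdd (nvar v) (NLit 1)))) (setn s0 v 0) s ->
    frame (for_ v e P) s0 s.
  move=> fs; apply: (@frame_trans _ _ (setn s0 v 0)); last first.
    by apply: frameW fs => a; rewrite /= ?inE ?mem_cat ?inE => ->; rewrite ?orbT.
  by split=> // a; rewrite inE negb_or => /andP[va _]; exact: upd_other.
have {}eN s : frame (Seq P (NSet v (NLit 0) (NAdd (nvar v) (NLit 1)))) (setn s0 v 0) s ->
    neval s e = N by move=> /f0 /eN.
apply: (runsW (runs_while _ _ T.+1 N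
  (fun k s => nmem s v 0 = k /\ inv k s /\ (k <= N)%N) _ _ _)).
- by split; [exact: (vv s0 0%N)|].
- move=> k s fs [vk [invk kN]] /=; rewrite eN // vk -ltnNge => k_N; split => //.
  rewrite -[T.+1]addn1; apply: runs_seq.
  apply: runsW (step k s k_N (f0 _ fs) vk invk) (leqnn _) _ => s' [fn _] inv'.
  by apply: runs_nset => /=; rewrite fn // vk addn1; split; first exact: vv.
- by [].
- move=> s' fs [k [_ [vk [invk kN]] /=]]; rewrite eN // vk -ltnNge -leqNgt => Nk.
  by have -> : N = k by apply/eqP; rewrite eqn_leq Nk kN.
Qed.

End ProgramLogic.

Arguments exec_frame {R P s t s'}.
Arguments runsW {R P s T T' post post'}.

(** * The search for good prices *)

(* Names of the arrays: in_* and out_* follow the input and output conventions,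
   v_* hold naturals and x_* reals.  Scalars are kept in cell 0. *)
Local Notation in_n := 0%N (only parsing).
Local Notation in_m := 1%N (only parsing).
Local Notation in_incidence := 2%N (only parsing).
Local Notation v_option := 4%N (only parsing).
Local Notation v_item := 5%N (only parsing).
Local Notation v_consumer := 6%N (only parsing).
Local Notation v_cell := 7%N (only parsing).
Local Notation v_options := 8%N (only parsing).
Local Notation v_parts := 9%N (only parsing).
Local Notation v_power := 10%N (only parsing).
Local Notation v_start := 11%N (only parsing).
Local Notation v_size := 12%N (only parsing).
Local Notation v_carry := 13%N (only parsing).
Local Notation v_uniform := 14%N (only parsing).
Local Notation in_delta := 0%N (only parsing).
Local Notation in_budget := 1%N (only parsing).
Local Notation out_price := 2%N (only parsing).
Local Notation x_best := 3%N (only parsing).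
Local Notation x_option := 4%N (only parsing).
Local Notation x_base := 5%N (only parsing).
Local Notation x_off := 6%N (only parsing).
Local Notation x_ask := 7%N (only parsing).
Local Notation x_income := 8%N (only parsing).
Local Notation x_exponent := 9%N (only parsing).
Local Notation x_cap := 10%N (only parsing).

Definition incr v := NSet v (NLit 0) (NAdd (nvar v) (NLit 1)).

Definition price_e := RGet x_option (NGet v_option (nvar v_item)).

(** Under SMP the test is constantly false, so that the price is always added. *)
Definition keep_b r :=
  match r with
  | UDP => BRle (rvar x_ask) price_e
  | SMP => BNle (NLit 1) (NLit 0)
  end.

Definition combine_e r :=
  match r with UDP => price_e | SMP => RAdd (rvar x_ask) price_e end.

(** Without multiplication of naturals the cell [c * n + i] is not computed; [v_cell] walks through
    the incidence matrix row by row instead, across successive consumers. *)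
Definition ask_cmd r :=
  for_ v_item (nvar in_n)
    (Seq (If (BNle (NLit 1) (NGet in_incidence (nvar v_cell)))
            (If (keep_b r) Skip (RSet x_ask (NLit 0) (combine_e r))) Skip)
         (incr v_cell)).

Definition income_cmd r :=
  Seq (RSet x_income (NLit 0) (RLit 0))
  (Seq (NSet v_cell (NLit 0) (NLit 0))
    (for_ v_consumer (nvar in_m)
      (Seq (RSet x_ask (NLit 0) (rvar x_off))
      (Seq (ask_cmd r)
        (If (BRle (rvar x_ask) (RGet in_budget (nvar v_consumer)))
          (RSet x_income (NLit 0) (RAdd (rvar x_income) (rvar x_ask)))
          Skip))))).

Definition try_cmd r :=
  Seq (income_cmd r)
    (If (BRle (rvar x_income) (rvar x_best)) Skip
      (Seq (RSet x_best (NLit 0) (rvar x_income))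
        (for_ v_item (nvar in_n) (RSet out_price (nvar v_item) price_e)))).

Section Correctness.
Context {R : realType}.
Variables (r : buying_rule) (n m : nat) (inc : nat -> nat -> bool) (B : nat -> R).
Implicit Types (P : cmd) (s : state R).

Definition input s := [/\ nmem s in_n 0 = n, nmem s in_m 0 = m,
  forall c i, (c < m)%N -> (i < n)%N ->
    (0 < nmem s in_incidence (c * n + i))%N = inc c i &
  forall c, (c < m)%N -> rmem s in_budget c = B c].

Lemma input_frame P s s' :
  frame P s s' -> input s ->
  all (fun a => a \notin nwrites P) [:: in_n; in_m; in_incidence] ->
  in_budget \notin rwrites P -> input s'.
Proof.
move=> [fn fr] [i0 i1 i2 i3] /and4P[h0 h1 h2 _] h3.
by split; rewrite ?fn ?fr.
Qed.

Arguments input_frame {P s s'}.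

(** The prices on trial are stored as option indices, which the odometer below can increment. *)
Definition prices s i := rmem s x_option (nmem s v_option i).

Lemma prices_frame P s s' : frame P s s' ->
  v_option \notin nwrites P -> x_option \notin rwrites P -> prices s' = prices s.
Proof. by move=> [fn fr] h h'; rewrite /prices fn // fr. Qed.

Arguments prices_frame {P s s'}.

Lemma runs_ask c s off : input s -> (c < m)%N -> nmem s v_cell 0 = (c * n)%N ->
  rmem s x_ask 0 = off ->
  runs (ask_cmd r) s (n * 6).+2 (fun s' => nmem s' v_cell 0 = (c.+1 * n)%N /\
    rmem s' x_ask 0 = ask r off (inc c) (prices s) n).
Proof.
move=> ins cm cells asks.
apply: (runsW (runs_for v_item (nvar in_n) _ 4 n (fun k s' =>
  nmem s' v_cell 0 = (c * n + k)%N /\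
  rmem s' x_ask 0 = ask r off (inc c) (prices s) k) s _ _ _ _)) => //.
- by move=> s' [fn _] /=; rewrite fn //; case: ins.
- by rewrite addn0.
- move=> k s' kn fs ik [ck ak].
  have [_ _ inc' _] := input_frame fs ins isT isT.
  have ps := prices_frame fs isT isT.
  have next s1 : nmem s1 v_cell 0 = (c * n + k)%N ->
      rmem s1 x_ask 0 = ask r off (inc c) (prices s) k.+1 ->
      runs (incr v_cell) s1 1 (fun s2 =>
        nmem (setn s2 v_item k.+1) v_cell 0 = (c * n + k.+1)%N /\
        rmem (setn s2 v_item k.+1) x_ask 0 = ask r off (inc c) (prices s) k.+1).
    move=> c1 a1; apply: runs_nset; split; last exact: a1.
    by rewrite /= /upd /= c1 -addnA addn1.
  apply: (runs_seq _ _ _ 3 1); apply: runs_if.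
  have -> : beval s' (BNle (NLit 1) (NGet in_incidence (nvar v_cell))) = inc c k.
    by rewrite /= ck inc'.
  case: ifP => ick; last first.
    by apply: (runs_le 1) => //; apply: runs_skip; apply: next; rewrite //= ick.
  have pk : rmem s' x_option (nmem s' v_option (nmem s' v_item 0)) = prices s k.
    by rewrite ik -ps.
  apply: runs_if; move: next ak; rewrite [ask _ _ _ _ k.+1]/= ick.
  case: (r) => next ak; last first.
    by apply: runs_rset; apply: next; rewrite //= /upd /= pk ak.
  have -> : beval s' (keep_b UDP) = (ask UDP off (inc c) (prices s) k <= prices s k).
    by rewrite /= ak pk.
  case: ifP => le.
    by apply: runs_skip; apply: next; rewrite //= min_l.
  apply: runs_rset; apply: next; rewrite //= /upd /= pk min_r //.
  by apply/ltW; rewrite ltNge le.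
- by move=> s' _; rewrite mulSn addnC.
Qed.

Lemma runs_income s : input s ->
  runs (income_cmd r) s (m * (n * 6 + 8) + 4) (fun s' =>
    rmem s' x_income 0 = total_pay r (rmem s x_off 0) n m inc B (prices s)).
Proof.
move=> ins; set off := rmem s x_off 0.
apply: (runs_le (1 + (1 + (m * (n * 6 + 6).+2).+2))); first by lia.
apply: runs_seq; apply: runs_rset; apply: runs_seq; apply: runs_nset.
set s1 := State _ _.
have ins1 : input s1 by [].
apply: (runsW (runs_for v_consumer (nvar in_m) _ (n * 6 + 6) m (fun k s' =>
  nmem s' v_cell 0 = (k * n)%N /\ rmem s' x_income 0 =
    \sum_(0 <= c < k) pay r off (inc c) (B c) (prices s) n) s1 _ _ _ _)) => //.
- by move=> s' [fn _] /=; rewrite fn //; case: ins.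
- by rewrite big_geq.
- move=> k s' km fs ck [cellk inck].
  have ins' := input_frame fs ins1 isT isT.
  have ps := prices_frame fs isT isT.
  have off' : rmem s' x_off 0 = off by case: fs => _ ->.
  apply: (runs_le (1 + ((n * 6).+2 + 2))); first by lia.
  apply: runs_seq; apply: runs_rset; apply: runs_seq.
  set s2 := State _ _.
  apply: (runsW (runs_ask k s2 off ins' km cellk off')) => //.
  move=> s3 fs3 [cell3]; rewrite [prices s2](_ : _ = prices s) ?ps //.
  set x := ask _ _ _ _ _ => x3.
  have inc3 : rmem s3 x_income 0 = \sum_(0 <= c < k) pay r off (inc c) (B c) (prices s) n.
    by rewrite -inck; case: fs3 => _ ->.
  have c3 : nmem s3 v_consumer 0 = k by rewrite -ck; case: fs3 => ->.
  have [_ _ _ B3] := input_frame fs3 (ins' : input s2) isT isT.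
  apply: runs_if.
  have -> : beval s3 (BRle (rvar x_ask) (RGet in_budget (nvar v_consumer))) = (x <= B k).
    by rewrite /= c3 x3 B3.
  have sumS : \sum_(0 <= c < k.+1) pay r off (inc c) (B c) (prices s) n =
      rmem s3 x_income 0 + (if x <= B k then x else 0).
    by rewrite big_nat_recr //= inc3.
  case: ifP sumS => xB sumS.
    apply: runs_rset; split; first exact: cell3.
    by rewrite sumS /= /upd /= x3.
  by apply: runs_skip; split; [exact: cell3|rewrite sumS addr0].
- by move=> s' _ [].
Qed.

Definition try_time := (m * (n * 6 + 8) + n * 3 + 8)%N.

Lemma runs_try s : input s ->
  let x := total_pay r (rmem s x_off 0) n m inc B (prices s) in
  runs (try_cmd r) s try_time (fun s' =>
    rmem s' x_best 0 = Num.max (rmem s x_best 0) x /\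
    forall i, (i < n)%N -> rmem s' out_price i =
      if x <= rmem s x_best 0 then rmem s out_price i else prices s i).
Proof.
move=> ins x.
apply: (runs_le ((m * (n * 6 + 8) + 4) + (1 + (n * 3).+2).+1)); first by rewrite /try_time; lia.
apply: runs_seq; apply: (runsW (runs_income s ins)) => // s1 fs1.
rewrite -/x => x1.
have best1 : rmem s1 x_best 0 = rmem s x_best 0 by case: fs1 => _ ->.
have out1 : rmem s1 out_price = rmem s out_price by case: fs1 => _ ->.
have ps1 := prices_frame fs1 isT isT.
have ins1 := input_frame fs1 ins isT isT.
apply: runs_if.
have -> : beval s1 (BRle (rvar x_income) (rvar x_best)) = (x <= rmem s x_best 0).
  by rewrite /= x1 best1.
case: ifP => xb.
  by apply: (runs_le 1) => //; apply: runs_skip; rewrite best1 out1 max_l.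
apply: runs_seq; apply: runs_rset; set s2 := State _ _.
apply: (runsW (runs_for v_item (nvar in_n) _ 1 n (fun k s' =>
  forall i, (i < k)%N -> rmem s' out_price i = prices s i) s2 _ _ _ _)) => //.
- by move=> s' [fn _] /=; rewrite fn //; case: ins1.
- move=> k s' kn fs ik outk; apply: runs_rset => i; rewrite ltnS leq_eqVlt /= /upd /= ik.
  have ps' := prices_frame fs isT isT.
  rewrite -[rmem s' _ (nmem s' _ k)]/(prices s' k) ps' -[prices s2]/(prices s1) ps1.
  by case: eqP => [->|_] //= ik'; apply: outk.
- move=> s3 fs3 out3; split=> //.
  case: fs3 => _ -> //; rewrite /= /upd /= x1 max_r //.
  by apply/ltW; rewrite ltNge xb.
Qed.

(** * Trying uniform prices and all price vectors on a group *)

Variables (W beta : R) (Q K : nat).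
Hypotheses (W0 : 0 <= W) (beta0 : 0 <= beta) (betaW : beta <= W).

Local Notation off := (off_price r W).
Local Notation opt := (price_option off beta).
Local Notation gain := (total_pay r off n m inc B).

Lemma eq_total_pay off' p p' : (forall i, (i < n)%N -> p i = p' i) ->
  total_pay r off' n m inc B p = total_pay r off' n m inc B p'.
Proof.
by move=> pp'; apply: eq_bigr => c _; rewrite /pay (eq_ask _ _ _ _ _ _ pp').
Qed.

Lemma price_option_bounds j : 0 <= opt j <= W.
Proof.
rewrite price_option_ge0 //; case: j => [|j]; first by case: (r) => /=.
by apply: le_trans betaW; apply: price_option_le.
Qed.

(** The bound by [W] ensures that capping the output at [W] changes nothing when it is read as a
    price function of the instance. *)
Definition good s := [/\ 0 <= rmem s x_best 0,
  rmem s x_best 0 <= gain (rmem s out_price) &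
  forall i, (i < n)%N -> 0 <= rmem s out_price i <= W].

Lemma good_frame P s s' : frame P s s' -> good s ->
  x_best \notin rwrites P -> out_price \notin rwrites P -> good s'.
Proof. by move=> [_ fr] gs h h'; rewrite /good !fr. Qed.

Arguments good_frame {P s s'}.

Definition ready s := [/\ input s, rmem s x_off 0 = off,
  forall j, (j <= Q)%N -> rmem s x_option j = opt j,
  nmem s v_options 0 = Q & nmem s v_parts 0 = K].

Lemma ready_frame P s s' : frame P s s' -> ready s ->
  all (fun a => a \notin nwrites P)
    [:: in_n; in_m; in_incidence; v_options; v_parts] ->
  all (fun a => a \notin rwrites P) [:: in_budget; x_off; x_option] -> ready s'.
Proof.
move=> fs [ins offs opts Qs Ks] /and5P[h0 h1 h2 h3 /andP[h4 _]] /and4P[k0 k1 k2 _].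
have [fn fr] := fs; split; rewrite ?fn ?fr //.
by apply: input_frame fs ins _ _ => //=; rewrite h0 h1 h2.
Qed.

Arguments ready_frame {P s s'}.

Lemma runs_try_good s : ready s -> good s ->
  (forall i, (i < n)%N -> (nmem s v_option i <= Q)%N) ->
  runs (try_cmd r) s try_time (fun s' => [/\ ready s', good s',
    rmem s x_best 0 <= rmem s' x_best 0 &
    gain (fun i => opt (nmem s v_option i)) <= rmem s' x_best 0]).
Proof.
move=> rs [best0 best_le out_bounds] idxQ; have [ins offs opts _ _] := rs.
apply: (runsW (runs_try s ins)) => // s' fs [].
have -> : total_pay r (rmem s x_off 0) n m inc B (prices s) =
    gain (fun i => opt (nmem s v_option i)).
  by rewrite offs; apply: eq_total_pay => i ilt; apply/opts/idxQ.
set x := gain _ => best' out'; split; rewrite ?best' ?le_max ?lexx ?orbT //.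
  exact: ready_frame fs rs isT isT.
split; rewrite ?best'.
- by rewrite le_max best0.
- have [le|lt] := leP x (rmem s x_best 0).
    apply: le_trans best_le _; rewrite le_eqVlt.
    by apply/orP; left; apply/eqP/eq_total_pay => i /out' ->; rewrite le.
  rewrite le_eqVlt; apply/orP; left; apply/eqP/eq_total_pay => i ilt.
  by rewrite out' // leNgt lt /=; apply/esym/opts/idxQ.
- move=> i ilt; rewrite out' //; case: ifP => _; first exact: out_bounds.
  by rewrite /prices opts ?idxQ // price_option_bounds.
Qed.

Definition fill_cmd e :=
  for_ v_item (nvar in_n) (NSet v_option (nvar v_item) e).

Lemma runs_fill e x s : nmem s in_n 0 = n ->
  (forall s', frame (fill_cmd e) s s' -> neval s' e = x) ->
  runs (fill_cmd e) s (n * 3).+2 (fun s' => forall i,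
    nmem s' v_option i = if (i < n)%N then x else nmem s v_option i).
Proof.
move=> nn ex.
apply: (runsW (runs_for v_item (nvar in_n) _ 1 n (fun k s' =>
  forall i, nmem s' v_option i = if (i < k)%N then x else nmem s v_option i) s _ _ _ _)) => //.
- by move=> s' [fn _] /=; rewrite fn.
- move=> k s' kn fs ik IH; apply: runs_nset => i.
  rewrite /= /upd /= ik ex //; case: eqP => [->|ki] /=; first by rewrite ltnSn.
  by rewrite IH ltnS [(i <= k)%N]leq_eqVlt (introF eqP ki).
Qed.

(** The final fill resets all digits of the odometer before the search of the groups. *)
Definition uniform_cmd :=
  Seq (for_ v_uniform (nvar v_options)
        (Seq (fill_cmd (NAdd (nvar v_uniform) (NLit 1))) (try_cmd r)))
      (fill_cmd (NLit 0)).

Definition uniform_time :=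
  ((Q * ((n * 3).+2 + try_time).+2).+2 + (n * 3).+2)%N.

Lemma runs_uniform s : ready s -> good s -> (forall i, nmem s v_option i = 0%N) ->
  runs uniform_cmd s uniform_time (fun s' => [/\ ready s', good s',
    forall i, nmem s' v_option i = 0%N &
    forall j, (j < Q)%N -> gain (fun=> opt j.+1) <= rmem s' x_best 0]).
Proof.
move=> rs gs idx0; apply: runs_seq.
apply: (runsW (runs_for v_uniform (nvar v_options) _ _ Q (fun k s' =>
  (* Cells from [n] on matter as well, because the last group may extend beyond the last item. *)
  [/\ ready s', good s', forall i, (n <= i)%N -> nmem s' v_option i = 0%N &
   forall j, (j < k)%N -> gain (fun=> opt j.+1) <= rmem s' x_best 0]) s _ _ _ _)) => //.
- by move=> s' [fn _] /=; rewrite fn //; case: rs.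
- by split=> // i _; exact: idx0.
- move=> k s' kQ fs jk [rs' gs' idx' gain'].
  apply: runs_seq; have [[n' _ _ _] _ _ _ _] := rs'.
  apply: (runsW (runs_fill _ k.+1 s' n' _)) => //.
    by move=> s2 [fn _] /=; rewrite fn // jk addn1.
  move=> s2 fs2 idx2.
  have rs2 := ready_frame fs2 rs' isT isT.
  have gs2 := good_frame fs2 gs' isT isT.
  have best2 : rmem s2 x_best 0 = rmem s' x_best 0 by case: fs2 => _ ->.
  apply: (runsW (runs_try_good s2 rs2 gs2 _)) => //.
    by move=> i ilt; rewrite idx2 ilt.
  move=> s3 [fn3 _] [rs3 gs3 best3 gain3]; split=> //.
    move=> i ni /=; rewrite /upd /= fn3 ?idx2; last by case: (r).
    by rewrite ltnNge ni /= idx'.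
  move=> j; rewrite ltnS leq_eqVlt => /orP[/eqP->|jk'].
    rewrite (eq_total_pay _ _ (fun i => opt (nmem s2 v_option i))) //.
    by move=> i ilt; rewrite idx2 ilt.
  by apply: le_trans best3; rewrite best2; apply: gain'.
- move=> s1 fs1 [rs1 gs1 idx1 gain1]; have [[n1 _ _ _] _ _ _ _] := rs1.
  apply: (runsW (runs_fill _ 0%N s1 n1 _)) => //.
  move=> s2 fs2 idx2; split.
  + exact: ready_frame fs2 rs1 isT isT.
  + exact: good_frame fs2 gs1 isT isT.
  + by move=> i; rewrite idx2; case: ltnP => // /idx1.
  + by move=> j jQ; case: fs2 => _ -> //; apply: gain1.
Qed.

(* The search of a group is an odometer: the option indices of its items are the
   digits of the number of price vectors tried so far, in base Q+1. *)
Definition digit (v i : nat) := ((v %/ Q.+1 ^ i) %% Q.+1)%N.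

Lemma digit_le v i : (digit v i <= Q)%N.
Proof. by rewrite -ltnS ltn_pmod. Qed.

(** A carry reaches position [i] exactly when [Q.+1 ^ i] divides [v.+1]; the digit then advances, or
    wraps around from [Q] to 0. *)
Lemma digitS v i :
  digit v.+1 i = if (Q.+1 ^ i %| v.+1)%N then
    (if (digit v i < Q)%N then (digit v i).+1 else 0%N) else digit v i.
Proof.
rewrite /digit divnS ?expn_gt0 //; case: ifP => _; last by rewrite add0n.
rewrite add1n modnS; set w := (v %/ _)%N.
have -> : (Q.+1 %| w.+1)%N = (w %% Q.+1 == Q)%N.
  rewrite /dvdn -(addn1 w) -modnDml.
  have wQ : (w %% Q.+1 <= Q)%N by rewrite -ltnS ltn_pmod.
  rewrite addn1; case: (w %% Q.+1 =P Q)%N => [->|wNQ]; first by rewrite modnn.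
  by apply/eqP; rewrite modn_small //; lia.
have wQ : (w %% Q.+1 <= Q)%N by rewrite -ltnS ltn_pmod.
by rewrite ltn_neqAle wQ andbT; case: eqP.
Qed.

(** The carry passes on from position [i] exactly when it arrived there and found the maximal
    digit. *)
Lemma dvdn_digitS v i : (Q.+1 ^ i.+1 %| v.+1)%N =
  (Q.+1 ^ i %| v.+1)%N && ~~ (digit v i < Q)%N.
Proof.
have b0 : (0 < Q.+1 ^ i)%N by rewrite expn_gt0.
case: (boolP (Q.+1 ^ i %| v.+1)%N) => [dv|ndv] /=; last first.
  apply: contraNF ndv; apply: dvdn_trans; exact: dvdn_exp2l.
have e : v.+1 = ((v %/ Q.+1 ^ i).+1 * Q.+1 ^ i)%N.
  by have := divnS v b0; rewrite dv add1n => <-; rewrite divnK.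
rewrite [in LHS]e expnS dvdn_pmul2r // -leqNgt /digit.
set w := (v %/ _)%N; have wQ : (w %% Q.+1 <= Q)%N by rewrite -ltnS ltn_pmod.
rewrite /dvdn -(addn1 w) -modnDml addn1.
case: (ltngtP (w %% Q.+1)%N Q) wQ => // [wQ|->] _; last by rewrite modnn.
by rewrite modn_small.
Qed.

(** Counting up to [Q.+1 ^ g] thus visits every price vector on a group. *)
Lemma digits_exist (g : nat) (f : nat -> nat) : (forall i, (f i <= Q)%N) ->
  exists2 v, (v < Q.+1 ^ g)%N & forall i, (i < g)%N -> digit v i = f i.
Proof.
move=> fQ; elim: g => [|g [v vg IH]]; first by exists 0%N.
exists (f g * Q.+1 ^ g + v)%N.
  rewrite expnS; apply: (@leq_trans (f g * Q.+1 ^ g + Q.+1 ^ g)).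
    by rewrite ltn_add2l.
  by rewrite -mulSnr leq_mul2r ltnS fQ orbT.
move=> i; rewrite ltnS leq_eqVlt /digit => /orP[/eqP->|ig].
  by rewrite divnMDl ?expn_gt0 // divn_small // addn0 modn_small // ltnS fQ.
have -> : (Q.+1 ^ g = Q.+1 ^ (g - i.+1) * Q.+1 * Q.+1 ^ i)%N.
  by rewrite -expnSr -expnD; congr expn; lia.
by rewrite !mulnA divnMDl ?expn_gt0 // modnMDl; apply: IH.
Qed.

Definition carry_cmd :=
  let cell := NAdd (nvar v_start) (nvar v_item) in
  for_ v_item (nvar v_size)
    (If (BNle (NLit 1) (nvar v_carry))
      (If (BNot (BNle (nvar v_options) (NGet v_option cell)))
        (Seq (NSet v_option cell (NAdd (NGet v_option cell) (NLit 1)))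
             (NSet v_carry (NLit 0) (NLit 0)))
        (NSet v_option cell (NLit 0)))
      Skip).

Definition shows g t v s := forall i, nmem s v_option i =
  if (i %/ g == t)%N then digit v (i - t * g) else 0%N.

(** The loop invariant: the first [k] digits are already those of [v.+1], the others still those of
    [v], and the flag records whether [Q.+1 ^ k] divides [v.+1]. *)
Lemma runs_carry g t v s : (0 < g)%N -> ready s -> shows g t v s ->
  nmem s v_start 0 = (t * g)%N -> nmem s v_size 0 = g -> nmem s v_carry 0 = 1%N ->
  runs carry_cmd s (g * 6).+2 (fun s' => shows g t v.+1 s' /\
    nmem s' v_carry 0 = (Q.+1 ^ g %| v.+1)%N).
Proof.
move=> g0 rs sh st sz cr.
apply: (runsW (runs_for v_item (nvar v_size) _ 4 g (fun k s' =>
  (forall i, nmem s' v_option i = if (i %/ g == t)%N then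
     (if (i - t * g < k)%N then digit v.+1 (i - t * g) else digit v (i - t * g))
     else 0%N) /\ nmem s' v_carry 0 = (Q.+1 ^ k %| v.+1)%N) s _ _ _ _)) => //.
- by move=> s' [fn _] /=; rewrite fn.
- by split=> [i|]; [exact: sh|rewrite expn0 dvd1n; exact: cr].
- move=> k s' kg fs ik [idx' cr'].
  have [_ _ _ q' _] := ready_frame fs rs isT isT.
  have st' : nmem s' v_start 0 = (t * g)%N by case: fs => -> .
  have part_k : ((t * g + k) %/ g = t)%N by rewrite divnMDl // divn_small // addn0.
  have idxk : nmem s' v_option (t * g + k) = digit v k.
    by rewrite idx' part_k eqxx addKn ltnn.
  have upd_idx x c s1 : x = digit v.+1 k -> c = (Q.+1 ^ k.+1 %| v.+1)%N ->
      nmem s1 v_carry 0 = c ->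
      (forall i, nmem s1 v_option i =
        if (i == t * g + k)%N then x else nmem s' v_option i) ->
      (forall i, nmem s1 v_option i = if (i %/ g == t)%N then
        (if (i - t * g < k.+1)%N then digit v.+1 (i - t * g) else digit v (i - t * g))
        else 0%N) /\ nmem s1 v_carry 0 = (Q.+1 ^ k.+1 %| v.+1)%N.
    move=> -> -> c1 idx1; split=> // i; rewrite idx1.
    case: eqP => [->|/eqP iN]; first by rewrite part_k eqxx addKn ltnSn.
    rewrite idx'; case: eqP => // it; rewrite ltnS [(i - t * g <= k)%N]leq_eqVlt.
    case: eqP => //= ik'; have := leq_trunc_div i g; rewrite it.
    by move/eqP: iN => iN tg; case: iN; rewrite -ik' subnKC.
  apply: runs_if.
  have -> : beval s' (BNle (NLit 1) (nvar v_carry)) = (Q.+1 ^ k %| v.+1)%N.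
    by rewrite /= cr'; case: (Q.+1 ^ k %| v.+1)%N.
  have := digitS v k; have := dvdn_digitS v k.
  case: (Q.+1 ^ k %| v.+1)%N cr' => cr' dS dgS; last first.
    apply: (runs_le 1) => //; apply: runs_skip.
    apply: (upd_idx (digit v k) false); [by rewrite dgS|by rewrite dS|exact: cr'|].
    by move=> i /=; case: eqP => // ->.
  apply: runs_if; set cell := NAdd _ _.
  have -> : beval s' (BNot (BNle (nvar v_options) (NGet v_option cell))) = (digit v k < Q)%N.
    by rewrite /= q' st' ik idxk -ltnNge.
  case: ifP dS dgS => dQ dS dgS.
    apply: (runs_seq _ _ _ 1 1); apply: runs_nset; apply: runs_nset.
    apply: (upd_idx (digit v k).+1 false); [by rewrite dgS|by rewrite dS|by []|].
    by move=> i; rewrite /= /upd /= st' ik idxk addn1.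
  apply: (runs_le 1) => //; apply: runs_nset.
  apply: (upd_idx 0%N true); [by rewrite dgS|by rewrite dS|exact: cr'|].
  by move=> i; rewrite /= /upd /= st' ik.
- move=> s' _ [idx' cr']; split=> // i; rewrite idx'; case: eqP => // it.
  by rewrite ifT // ltn_subLR -?it ?leq_trunc_div // -mulSnr ltn_ceil.
Qed.

(** After its last step the odometer has wrapped around to zero, ready for the next group. *)
Lemma digit_expn g i : (i < g)%N -> digit (Q.+1 ^ g) i = 0%N.
Proof.
move=> ig; rewrite /digit -expnB // ?(ltnW ig) //.
by apply/eqP; rewrite -/(dvdn _ _) -[X in (X %| _)%N]expn1 dvdn_exp2l // subn_gt0.
Qed.

Definition group_cmd :=
  Seq (NSet v_carry (NLit 0) (NLit 0))
    (While (BNle (nvar v_carry) (NLit 0))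
      (Seq (try_cmd r) (Seq (NSet v_carry (NLit 0) (NLit 1)) carry_cmd))).

Definition group_time g :=
  (1 + (Q.+1 ^ g * (try_time + (1 + (g * 6).+2)).+1).+1)%N.

Definition group_price g t (f : nat -> nat) i :=
  opt (if (i %/ g == t)%N then f (i - t * g)%N else 0%N).

(** The iteration count [v] is the number shown by the odometer. A carry out of the top digit
    signals that all [Q.+1 ^ g] vectors have been tried. *)
Lemma runs_group g t s : (0 < g)%N -> ready s -> good s ->
  (forall i, nmem s v_option i = 0%N) ->
  nmem s v_start 0 = (t * g)%N -> nmem s v_size 0 = g ->
  runs group_cmd s (group_time g) (fun s' => [/\ ready s', good s',
    forall i, nmem s' v_option i = 0%N,
    rmem s x_best 0 <= rmem s' x_best 0 &
    forall f : nat -> nat, (forall k, (f k <= Q)%N) ->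
      gain (group_price g t f) <= rmem s' x_best 0]).
Proof.
move=> g0 rs gs idx0 st sz; apply: runs_seq; apply: runs_nset; set s1 := State _ _.
apply: (runsW (runs_while _ _ _ (Q.+1 ^ g) (fun v s' =>
  [/\ ready s', good s', shows g t v s', nmem s' v_carry 0 = (v == Q.+1 ^ g)%N &
   [/\ (v <= Q.+1 ^ g)%N, rmem s x_best 0 <= rmem s' x_best 0 &
   forall u, (u < v)%N -> gain (group_price g t (digit u)) <= rmem s' x_best 0]]) s1 _ _)) => //.
- split=> //.
  + by move=> i /=; rewrite /upd /= idx0 /digit div0n mod0n; case: ifP.
  + by rewrite /= /upd /= eq_sym expn_eq0.
- move=> v s2 fs [rs2 gs2 sh2 carry2 [vg best2 gain2]] /=.
  rewrite carry2 leqn0 eqb0 => vNg; have {}vg : (v < Q.+1 ^ g)%N by rewrite ltn_neqAle vNg.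
  split=> //; apply: runs_seq.
  have idxQ i : (nmem s2 v_option i <= Q)%N by rewrite sh2; case: ifP => // _; exact: digit_le.
  apply: (runsW (runs_try_good s2 rs2 gs2 (fun i _ => idxQ i))) => // s3 fs3.
  move=> [rs3 gs3 best3 gain3]; apply: runs_seq; apply: runs_nset; set s4 := State _ _.
  have sh4 : shows g t v s4 by move=> i; rewrite -sh2; case: fs3 => fn _; rewrite /= /upd /= fn.
  have st4 : nmem s4 v_start 0 = (t * g)%N.
    by case: fs3 => fn3 _; case: fs => fn _; rewrite /= /upd /= fn3 // fn.
  have sz4 : nmem s4 v_size 0 = g.
    by case: fs3 => fn3 _; case: fs => fn _; rewrite /= /upd /= fn3 // fn.
  apply: (runsW (runs_carry g t v s4 g0 rs3 sh4 st4 sz4 (erefl _))) => //.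
  move=> s5 fs5 [sh5 carry5].
  have best5 : rmem s5 x_best 0 = rmem s3 x_best 0 by case: fs5 => _ ->.
  split=> //.
  + exact: ready_frame fs5 (rs3 : ready s4) isT isT.
  + exact: good_frame fs5 (gs3 : good s4) isT isT.
  (* As [v < Q.+1 ^ g], the power divides [v.+1] only if they are equal. *)
  + rewrite carry5; congr nat_of_bool; apply/idP/eqP => [/(dvdn_leq (ltn0Sn v))|->//].
    by move=> gv; apply/eqP; rewrite eqn_leq vg gv.
  split=> //; rewrite best5; first exact: le_trans best2 best3.
  move=> u; rewrite ltnS leq_eqVlt => /orP[/eqP->|uv].
    apply: le_trans gain3; rewrite le_eqVlt; apply/orP; left; apply/eqP/eq_total_pay.
    by move=> i _; rewrite sh2.
  by apply: le_trans best3; apply: gain2.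
- move=> s' _ [v [_ [rs' gs' sh' carry' [vg best' gain']] /=]].
  rewrite carry' -ltnNge lt0b => /eqP vE; split=> //.
    move=> i; rewrite sh' vE; case: eqP => // it; apply: digit_expn.
    by rewrite ltn_subLR -?it ?leq_trunc_div // -mulSnr ltn_ceil.
  move=> f fQ; have [u ug uf] := digits_exist g f fQ.
  have -> : gain (group_price g t f) = gain (group_price g t (digit u)).
    apply: eq_total_pay => i _; rewrite /group_price; case: eqP => // it.
    by rewrite uf // ltn_subLR -?it ?leq_trunc_div // -mulSnr ltn_ceil.
  by apply: gain'; rewrite vE.
Qed.

Definition groups_cmd :=
  Seq (NSet v_start (NLit 0) (NLit 0))
    (While (BNot (BNle (nvar in_n) (nvar v_start)))
      (Seq group_cmd (NSet v_start (NLit 0) (NAdd (nvar v_start) (nvar v_size))))).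

(** The loop stops at the first group starting at or beyond [n], after [G'] groups; these already
    cover all items, and [G] only bounds their number. *)
Lemma runs_groups g G s : ((0 < n) ==> (0 < g))%N -> (n <= G * g)%N ->
  ready s -> good s -> (forall i, nmem s v_option i = 0%N) -> nmem s v_size 0 = g ->
  runs groups_cmd s (1 + (G * (group_time g + 1).+1).+1) (fun s' =>
    good s' /\ exists2 G', (G' <= G)%N &
    [/\ (n <= G' * g)%N, rmem s x_best 0 <= rmem s' x_best 0 &
     forall t (f : nat -> nat), (t < G')%N -> (forall k, (f k <= Q)%N) ->
       gain (group_price g t f) <= rmem s' x_best 0]).
Proof.
move=> ng nG rs gs idx0 sz; apply: runs_seq; apply: runs_nset; set s1 := State _ _.
apply: (runsW (runs_while _ _ _ G (fun t s' =>
  [/\ ready s', good s', forall i, nmem s' v_option i = 0%N, nmem s' v_start 0 = (t * g)%N &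
   rmem s x_best 0 <= rmem s' x_best 0 /\ forall u (f : nat -> nat), (u < t)%N ->
   (forall k, (f k <= Q)%N) -> gain (group_price g u f) <= rmem s' x_best 0]) s1 _ _)) => //.
- move=> t s2 fs [rs2 gs2 idx2 st2 [best2 gain2]] /=; rewrite st2.
  have [[n2 _ _ _] _ _ _ _] := rs2; rewrite n2 -ltnNge => tgn.
  have g0 : (0 < g)%N by apply: (implyP ng); apply: leq_ltn_trans tgn.
  split; first by rewrite -(ltn_pmul2r g0); apply: leq_trans nG.
  apply: runs_seq; have sz2 : nmem s2 v_size 0 = g by case: fs => ->.
  apply: (runsW (runs_group g t s2 g0 rs2 gs2 idx2 st2 sz2)) => //.
  move=> s3 [fn _] [rs3 gs3 idx3 best3 gain3]; apply: runs_nset; split=> //.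
    by rewrite /= /upd /= !fn // st2 sz2 mulSnr.
  split; first exact: le_trans best2 best3.
  move=> u f; rewrite ltnS leq_eqVlt => /orP[/eqP->|ut] fQ; first exact: gain3.
  by apply: le_trans best3; apply: gain2.
- move=> s' _ [t [tG [rs' gs' _ st' [best' gain']] /=]]; rewrite st' negbK.
  by have [[-> _ _ _] _ _ _ _] := rs' => ntg; split=> //; exists t.
Qed.

End Correctness.

Arguments input_frame {R n m inc B P s s'}.
Arguments ready_frame {R r n m inc B W beta Q K P s s'}.
Arguments good_frame {R r n m inc B W P s s'}.

(** * The program *)

(** Multiplication by a constant of the program, unfolded into additions. *)
Fixpoint nscale (C : nat) (e : nexp) :=
  if C is C'.+1 then NAdd e (nscale C' e) else NLit 0.

Lemma neval_nscale {R : realType} (s : state R) C e : neval s (nscale C e) = (C * neval s e)%N.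
Proof. by elim: C => //= C ->; rewrite mulSn. Qed.

(** One pass over the incidence matrix yields a cap above all budgets and the largest budget over
    nonempty bundles. *)
Definition market_cmd :=
  Seq (RSet x_cap (NLit 0) (RLit 1))
  (Seq (NSet v_cell (NLit 0) (NLit 0))
    (for_ v_consumer (nvar in_m)
      (Seq (RSet x_cap (NLit 0)
             (RAdd (rvar x_cap) (RGet in_budget (nvar v_consumer))))
        (for_ v_item (nvar in_n)
          (Seq
            (If (BAnd (BNle (NLit 1) (NGet in_incidence (nvar v_cell)))
                  (BNot (BRle (RGet in_budget (nvar v_consumer)) (rvar x_base))))
              (RSet x_base (NLit 0) (RGet in_budget (nvar v_consumer))) Skip)
            (incr v_cell)))))).

Definition off_e r := match r with UDP => rvar x_cap | SMP => RLit 0 end.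

Definition options_cmd r :=
  Seq (RSet x_off (NLit 0) (off_e r))
  (Seq (RSet x_option (NLit 0) (rvar x_off))
  (Seq (RSet x_option (NLit 1) (rvar x_base))
  (Seq (NSet v_power (NLit 0) (NLit 1))
  (Seq (NSet v_options (NLit 0) (NLit 2))
  (Seq (While (BNot (BNle (NAdd (nvar in_n) (nvar in_m)) (nvar v_power)))
         (Seq (NSet v_power (NLit 0) (NAdd (nvar v_power) (nvar v_power)))
              (NSet v_options (NLit 0) (NAdd (nvar v_options) (NLit 2)))))
    (for_ v_item (nvar v_options)
      (RSet x_option (NAdd (nvar v_item) (NLit 2))
        (RDiv (RGet x_option (NAdd (nvar v_item) (NLit 1))) (RLit 2))))))))).

(** There is no rounding of reals, so [delta * floor (log2 n)] is built by repeated addition while a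
    power of 2 grows up to [n]; its integer part is then peeled off by ones, doubling [v_parts] each
    time. *)
Definition parts_cmd :=
  Seq (NSet v_power (NLit 0) (NLit 1))
  (Seq (NSet v_parts (NLit 0) (NLit 1))
  (Seq (RSet x_exponent (NLit 0) (RLit 0))
  (Seq (While (BNle (NAdd (nvar v_power) (nvar v_power)) (nvar in_n))
         (Seq (NSet v_power (NLit 0) (NAdd (nvar v_power) (nvar v_power)))
              (RSet x_exponent (NLit 0) (RAdd (rvar x_exponent) (rvar in_delta)))))
       (While (BRle (RLit 1) (rvar x_exponent))
         (Seq (RSet x_exponent (NLit 0) (RSub (rvar x_exponent) (RLit 1)))
              (NSet v_parts (NLit 0) (NAdd (nvar v_parts) (nvar v_parts)))))))).

(** A ceiling division of [n] by [C * K], done by repeated addition. *)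
Definition size_cmd C :=
  Seq (NSet v_size (NLit 0) (NLit 0))
  (Seq (NSet v_power (NLit 0) (NLit 0))
    (While (BNot (BNle (nvar in_n) (nvar v_power)))
      (Seq (NSet v_power (NLit 0) (NAdd (nvar v_power) (nscale C (nvar v_parts))))
           (incr v_size)))).

(** * Correctness of the preparatory computations *)

Section Preparation.
Context {R : realType}.
Variables (r : buying_rule) (n m : nat) (inc : nat -> nat -> bool) (B : nat -> R).
Implicit Types (P : cmd) (s : state R).
Local Notation input := (input n m inc B).

(** The relation [D] describes the cells of the matrix scanned so far. *)
Definition is_base (D : nat -> nat -> Prop) (x : R) := [/\ 0 <= x,
  forall c i, (c < m)%N -> (i < n)%N -> D c i -> inc c i -> B c <= x &
  x = 0 \/ exists c i, [/\ (c < m)%N, (i < n)%N, inc c i & B c = x]].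

Lemma runs_market s : input s -> rmem s x_base 0 = 0 ->
  runs market_cmd s (m * (n * 5 + 5) + 4) (fun s' =>
    rmem s' x_cap 0 = 1 + \sum_(0 <= c < m) B c /\
    is_base (fun _ _ => True) (rmem s' x_base 0)).
Proof.
move=> ins base0.
apply: (runs_le (1 + (1 + (m * (n * 5 + 3).+2).+2))); first by lia.
apply: runs_seq; apply: runs_rset; apply: runs_seq; apply: runs_nset; set s1 := State _ _.
apply: (runsW (runs_for v_consumer (nvar in_m) _ _ m (fun k s' =>
  [/\ nmem s' v_cell 0 = (k * n)%N, rmem s' x_cap 0 = 1 + \sum_(0 <= c < k) B c &
   is_base (fun c _ => (c < k)%N) (rmem s' x_base 0)]) s1 _ _ _ _)) => //.
- by move=> s' [fn _] /=; rewrite fn //; case: ins.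
- split=> //; first by rewrite big_geq // addr0.
  by rewrite /= /upd /= base0; split=> //; left.
- move=> k s' km fs ck [cell cap base].
  have ins' := input_frame fs (ins : input s1) isT isT.
  have [n' _ _ B'] := ins'.
  apply: (runs_le (1 + (n * 4.+1).+2)); first by lia.
  apply: runs_seq; apply: runs_rset; set s2 := State _ _.
  apply: (runsW (runs_for v_item (nvar in_n) _ 3 n (fun l s3 =>
    nmem s3 v_cell 0 = (k * n + l)%N /\
    is_base (fun c i => (c < k)%N \/ c = k /\ (i < l)%N) (rmem s3 x_base 0)) s2 _ _ _ _)) => //.
  + by move=> s3 [fn _] /=; rewrite fn.
  + split; first by rewrite addn0.
    have [b0 b1 b2] := base; split=> // c i cm ilt [|[]//]; exact: b1.
  + move=> l s3 ln fs3 il [cell3 [b0 b1 b2]].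
    have [_ _ inc3 B3] := input_frame fs3 (ins' : input s2) isT isT.
    have c3 : nmem s3 v_consumer 0 = k by case: fs3 => ->.
    have next s4 : nmem s4 v_cell 0 = (k * n + l)%N ->
        is_base (fun c i => (c < k)%N \/ c = k /\ (i < l.+1)%N) (rmem s4 x_base 0) ->
        runs (incr v_cell) s4 1 (fun s5 =>
          nmem (setn s5 v_item l.+1) v_cell 0 = (k * n + l.+1)%N /\
          is_base (fun c i => (c < k)%N \/ c = k /\ (i < l.+1)%N)
            (rmem (setn s5 v_item l.+1) x_base 0)).
      move=> cell4 base4; apply: runs_nset; split; last exact: base4.
      by rewrite /= /upd /= cell4 -addnA addn1.
    apply: (runs_seq _ _ _ 2 1); apply: runs_if.
    set b := beval _ _; have {b}-> : b = inc k l && ~~ (B k <= rmem s3 x_base 0).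
      by rewrite /b /= cell3 inc3 // c3 B3.
    case: ifP => [/andP[ikl]|].
      rewrite -ltNge => lt; apply: runs_rset; apply: next; first exact: cell3.
      rewrite /= /upd /= c3 B3 //; split.
      * by apply: le_trans b0 (ltW lt).
      * move=> c i cm ilt [ck'|[-> _]] ici //.
        by apply: le_trans (ltW lt); apply: b1 ici => //; left.
      * by right; exists k, l.
    move=> /negbT; rewrite negb_and negbK => H; apply: runs_skip; apply: next => //.
    split=> // c i cm ilt [ck'|[ck' il']] ici; first by apply: b1 ici => //; left.
    move: il'; rewrite ltnS leq_eqVlt => /orP[/eqP il'|il'].
      by move: H; rewrite -ck' -il' ici.
    by apply: b1 ici => //; right.
  + move=> s3 fs3 [cell3 [b0 b1 b2]]; split.
    * by rewrite /= /upd /= cell3 mulSnr.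
    * case: fs3 => _ fr; rewrite /= /upd /= fr //= /upd /= cap ck B' //.
      by rewrite big_nat_recr //= addrA.
    * split=> // c i cm ilt; rewrite ltnS leq_eqVlt => /orP[/eqP->|ck'] ici.
        by move: (ici); apply: b1 => //; right.
      by move: (ici); apply: b1 => //; left.
- by move=> s' _ [_ cap [b0 b1 b2]]; split=> //; split=> // c i cm ilt _; apply: b1.
Qed.

Definition options_time l := (9 * l + 14)%N.

Lemma runs_options s W beta : input s -> rmem s x_cap 0 = W -> rmem s x_base 0 = beta ->
  exists2 l, (n + m <= 2 ^ l)%N && ((l == 0%N) || (2 ^ l < 2 * (n + m))%N) &
  runs (options_cmd r) s (options_time l) (fun s' =>
    [/\ rmem s' x_off 0 = off_price r W, nmem s' v_options 0 = (2 * l + 2)%N &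
    forall j, (j <= 2 * l + 2)%N ->
      rmem s' x_option j = price_option (off_price r W) beta j]).
Proof.
move=> ins capW baseb.
have ex : exists l, (n + m <= 2 ^ l)%N by exists (n + m)%N; apply/ltnW/ltn_expl.
case: (ex_minnP ex) => l nml lmin; exists l.
  rewrite nml /=; case: l nml lmin => //= l _ lmin; rewrite expnS ltn_pmul2l //.
  by rewrite ltnNge; apply/negP => /lmin; rewrite ltnn.
apply: (runs_le (1 + (1 + (1 + (1 + (1 + ((l * 2.+1).+1 + ((2 * l + 2) * 3).+2)))))));
  first by rewrite /options_time; lia.
apply: runs_seq; apply: runs_rset; apply: runs_seq; apply: runs_rset.
apply: runs_seq; apply: runs_rset; apply: runs_seq; apply: runs_nset.
apply: runs_seq; apply: runs_nset; apply: runs_seq; set s1 := State _ _.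
have off1 : rmem s1 x_off 0 = off_price r W.
  by rewrite /s1 /off_e; case: (r); rewrite /= /upd.
have opt10 : rmem s1 x_option 0 = off_price r W by exact: off1.
have opt11 : rmem s1 x_option 1 = beta by exact: baseb.
have ins1 : input s1 by [].
have [n1 m1 _ _] := ins1.
apply: (runsW (runs_while _ _ _ l (fun k s' =>
  nmem s' v_power 0 = (2 ^ k)%N /\ nmem s' v_options 0 = (2 * k + 2)%N) s1 _ _)) => //.
- move=> k s2 fs [pow opt] /=; rewrite pow.
  have -> : nmem s2 0 0 = n by case: fs => ->.
  have -> : nmem s2 1 0 = m by case: fs => ->.
  rewrite -ltnNge => lt; split.
    by rewrite -(ltn_exp2l _ _ (isT : 1 < 2)%N); apply: leq_trans nml.
  apply: (runs_seq _ _ _ 1 1); apply: runs_nset; apply: runs_nset; split.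
    by rewrite /= /upd /= pow addnn -mul2n -expnS.
  by rewrite /= /upd /= opt; lia.
move=> s2 fs [k [kl [pow opt] /=]]; rewrite pow negbK.
have -> : nmem s2 0 0 = n by case: fs => ->.
have -> : nmem s2 1 0 = m by case: fs => ->.
(* The loop exits at the least exponent, because [l] was chosen minimal. *)
move=> /lmin lk; have {kl lk} kE : k = l by apply/eqP; rewrite eqn_leq kl lk.
rewrite kE in opt.
apply: (runsW (runs_for v_item (nvar v_options) _ 1 (2 * l + 2) (fun k s' =>
  forall j, (j <= k.+1)%N -> rmem s' x_option j = price_option (off_price r W) beta j)
  s2 _ _ _ _)) => //.
- by move=> s3 [fn _] /=; rewrite fn.
- move=> j j1; case: fs => _ fr; rewrite /= fr //.
  by case: j j1 => [|[|]] //= _; rewrite ?opt11 ?expr0 ?divr1.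
- move=> i s3 il fs3 ii IH; apply: runs_rset => j.
  rewrite leq_eqVlt /= /upd /= ii addn2 addn1 ltnS; case: eqP => [-> _|_ /= ji].
    by rewrite IH //= exprSr invfM mulrA.
  exact: IH.
- move=> s3 fs3 opts; split.
  + case: fs3 => _ fr3; case: fs => _ fr; rewrite fr3 // fr //.
  + by case: fs3 => fn _; rewrite fn.
  + by move=> j jl; apply: opts; apply: leqW.
Qed.

Lemma runs_parts s delta (D : nat) : nmem s in_n 0 = n -> rmem s in_delta 0 = delta ->
  0 < delta -> delta <= D%:R ->
  runs parts_cmd s (n * 3 + D * n * 3 + 5) (fun s' => exists l k,
    [/\ nmem s' v_parts 0 = (2 ^ k)%N, (0 < n -> 2 ^ l <= n)%N, (n < 2 ^ l.+1)%N &
     k%:R <= delta * l%:R < k.+1%:R]).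
Proof.
move=> ns ds d0 dD.
apply: (runs_le (1 + (1 + (1 + ((n * 2.+1).+1 + (D * n * 2.+1).+1))))); first by lia.
apply: runs_seq; apply: runs_nset; apply: runs_seq; apply: runs_nset.
apply: runs_seq; apply: runs_rset; apply: runs_seq; set s1 := State _ _.
apply: (runsW (runs_while _ _ _ n (fun l s' =>
  [/\ nmem s' v_power 0 = (2 ^ l)%N, rmem s' x_exponent 0 = delta * l%:R &
   (0 < n -> 2 ^ l <= n)%N]) s1 _ _)) => //.
- by split=> //=; rewrite /upd /= mulr0.
- move=> l s2 fs [pow ex le] /=; rewrite pow addnn -mul2n -expnS.
  have -> : nmem s2 0 0 = n by case: fs => ->.
  move=> le2; split; first by apply: leq_trans (ltnW (ltn_expl l.+1 (isT : 1 < 2)%N)) le2.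
  apply: (runs_seq _ _ _ 1 1); apply: runs_nset; apply: runs_rset; split=> //.
    by rewrite /= /upd /= pow addnn -mul2n -expnS.
  rewrite /= /upd /= ex; have -> : rmem s2 0 0 = delta by case: fs => _ ->.
  by rewrite -natr1 mulrDr mulr1.
- move=> s2 fs [l [ln [pow ex le] /=]].
  have -> : nmem s2 0 0 = n by case: fs => ->.
  rewrite pow addnn -mul2n -expnS -ltnNge => lt.
  have part2 : nmem s2 v_parts 0 = 1%N by case: fs => ->.
  apply: (runsW (runs_while _ _ _ (D * n) (fun k s' =>
    [/\ nmem s' v_parts 0 = (2 ^ k)%N, rmem s' x_exponent 0 = delta * l%:R - k%:R &
    k%:R <= delta * l%:R]) s2 _ _)) => //.
  + by split; rewrite ?subr0 ?mulr_ge0 ?(ltW d0).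
  + move=> k s3 fs3 [part3 ex3 le3] /=; rewrite ex3 => le1.
    have lek : k.+1%:R <= delta * l%:R by rewrite -natr1; lra.
    split.
      (* The number of halting-free subtractions is at most [delta * l <= D * n]. *)
      rewrite -(ler_nat R); apply: le_trans lek _; rewrite natrM.
      by apply: ler_pM => //; rewrite ?ler_nat // ltW.
    apply: (runs_seq _ _ _ 1 1); apply: runs_rset; apply: runs_nset; split=> //.
      by rewrite /= /upd /= part3 addnn -mul2n -expnS.
    by rewrite /= /upd /= ex3 -natr1; lra.
  + move=> s3 _ [k [_ [part3 ex3 le3] /=]]; rewrite ex3 -ltNge => lt1.
    by exists l, k; split=> //; rewrite le3 -natr1; lra.
Qed.

Lemma runs_size s C K : (0 < C * K)%N -> nmem s in_n 0 = n -> nmem s v_parts 0 = K ->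
  runs (size_cmd C) s (n * 3 + 3) (fun s' => exists g,
    [/\ nmem s' v_size 0 = g, (n <= C * K * g)%N, (0 < n -> 0 < g)%N, (g <= n)%N &
     (g.-1 * (C * K) < n \/ g = 0)%N]).
Proof.
move=> CK ns Ks; apply: (runs_le (1 + (1 + (n * 2.+1).+1))); first by lia.
apply: runs_seq; apply: runs_nset; apply: runs_seq; apply: runs_nset; set s1 := State _ _.
apply: (runsW (runs_while _ _ _ n (fun g s' =>
  [/\ nmem s' v_size 0 = g, nmem s' v_power 0 = (C * K * g)%N &
   (g.-1 * (C * K) < n \/ g = 0)%N]) s1 _ _)) => //.
- by split=> //; [rewrite muln0|right].
- move=> g s2 fs [sz pow le] /=; rewrite pow.
  have -> : nmem s2 0 0 = n by case: fs => ->.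
  rewrite -ltnNge => lt; split.
    by apply: leq_ltn_trans lt; rewrite leq_pmull.
  apply: (runs_seq _ _ _ 1 1); apply: runs_nset; apply: runs_nset; split.
  + by rewrite /= /upd /= sz addn1.
  + rewrite /= /upd /= pow neval_nscale /=.
    have -> : nmem s2 9 0 = K by case: fs => ->.
    by rewrite mulnSr.
  + by left; rewrite mulnC.
- move=> s2 fs [g [gn [sz pow le] /=]]; rewrite pow negbK.
  have -> : nmem s2 0 0 = n by case: fs => ->.
  move=> ng; exists g; split=> // n0; move: ng; case: (g) => //.
  by rewrite muln0 leqNgt n0.
Qed.

End Preparation.

(** * The whole program: approximation guarantee and step count *)

Definition program r C :=
  Seq market_cmd (Seq (options_cmd r) (Seq parts_cmd (Seq (uniform_cmd r)
    (If (BNle (nvar v_options) (nscale C (nvar v_parts))) Skip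
      (Seq (size_cmd C) (groups_cmd r)))))).

Section ProgramCorrect.
Context {R : realType}.
Variables (r : buying_rule) (n m : nat) (inc : nat -> nat -> bool) (B : nat -> R).

Definition parts_spec (delta : R) K := exists l k,
  [/\ K = (2 ^ k)%N, (0 < n -> 2 ^ l <= n)%N, (n < 2 ^ l.+1)%N &
   k%:R <= delta * l%:R < k.+1%:R].

Definition options_spec Q := exists l, [/\ Q = (2 * l + 2)%N, (n + m <= 2 ^ l)%N &
  (l == 0%N) || (2 ^ l < 2 * (n + m))%N].

Definition prep_time (D Q : nat) :=
  (m * (n * 5 + 5) + 9 * Q + n * 3 + D * n * 3 + uniform_time n m Q + 30)%N.

Definition search_time CK Q g := (n * 3 + CK * (group_time n m Q g + 2) + 5)%N.

(** The guarantee is [2 * (C * K) + 1] in both branches: the uniform prices give [2 * Q + 1] with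
    [Q <= C * K], the group search uses at most [C * K] groups. The step count keeps the branches
    apart, since the search has to be paid for only when [C * K < Q]. *)
Lemma program_correct s (delta : R) (D C : nat) : (0 < C)%N ->
  0 < delta -> delta <= D%:R -> input n m inc B s -> (forall c, 0 <= B c) ->
  rmem s in_delta 0 = delta -> (forall a j, (1 < a)%N -> rmem s a j = 0) ->
  (forall a j, (2 < a)%N -> nmem s a j = 0%N) ->
  let W := 1 + \sum_(0 <= c < m) B c in
  let gain := total_pay r (off_price r W) n m inc B in
  exists t s' K Q, [/\ exec (program r C) s t s',
    (forall i, (i < n)%N -> 0 <= rmem s' out_price i <= W),
    0 <= rmem s' x_best 0,
    rmem s' x_best 0 <= gain (rmem s' out_price) &
    [/\ (0 < n)%N -> forall y, (forall i, 0 <= y i) ->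
        gain y <= (2 * (C * K) + 1)%:R * rmem s' x_best 0,
    parts_spec delta K, options_spec Q &
    (t <= prep_time D Q)%N \/
    exists g, [/\ (C * K < Q)%N, (g <= n)%N, (g.-1 * (C * K) < n \/ g = 0)%N &
      (t <= prep_time D Q + search_time (C * K) Q g)%N]]].
Proof.
move=> C0 d0 dD ins B0 ds r0 n0 W gain.
have W0 : 0 <= W by rewrite addr_ge0 ?sumr_ge0.
have BW c : (c < m)%N -> B c < W.
  move=> cm; rewrite /W (bigD1_seq c) ?iota_uniq ?mem_index_iota //=.
  have : 0 <= \sum_(0 <= i < m | i != c) B i by apply: sumr_ge0.
  lra.
have [t1 [s1 [e1 T1 [cap1 [beta0 beta1 beta2]]]]] := runs_market n m inc B s ins (r0 5%N 0%N isT).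
have fs1 := exec_frame e1.
have ins1 := input_frame fs1 ins isT isT.
set beta := rmem s1 _ _ in beta0 beta1 beta2.
have betaW : beta <= W by case: beta2 => [->//|[c [i [cm _ _ <-]]]]; apply/ltW/BW.
have [lq /andP[nmq minq] [t2 [s2 [e2 T2 [off2 opts2 opt2]]]]] :=
  runs_options r n m inc B s1 W beta ins1 cap1 (erefl _).
have fs2 := exec_frame e2.
have ins2 := input_frame fs2 ins1 isT isT.
have [n2 _ _ _] := ins2.
have delta2 : rmem s2 in_delta 0 = delta.
  by case: fs2 => _ -> //; case: fs1 => _ -> .
have [t3 [s3 [e3 T3 [l [k [Kk ln nl kl]]]]]] := runs_parts n s2 delta D n2 delta2 d0 dD.
have fs3 := exec_frame e3.
have ins3 := input_frame fs3 ins2 isT isT.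
pose K := nmem s3 v_parts 0; pose Q := (2 * lq + 2)%N.
have rs3 : ready r n m inc B W beta Q K s3.
  by case: (fs3) => fn fr; split=> //; rewrite ?fn ?fr.
have rmem3 a j : a \in [:: out_price; x_best] -> rmem s3 a j = 0.
  rewrite !inE; case: fs3 fs2 fs1 => _ fr3 [_ fr2] [_ fr1].
  by move=> /orP[] /eqP->; rewrite fr3 // fr2 // fr1 // r0.
have gs3 : good r n m inc B W s3.
  split=> [||i _]; rewrite !rmem3 ?lexx //.
  by apply: total_pay_ge0 => // i _; rewrite rmem3.
have idx3 i : nmem s3 v_option i = 0%N.
  case: fs3 fs2 fs1 => fn3 _ [fn2 _] [fn1 _].
  by rewrite fn3 // fn2 // fn1 // n0.
have [t4 [s4 [e4 T4 [rs4 gs4 idx4 gain4]]]] :=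
  runs_uniform r n m inc B W beta Q K W0 beta0 betaW s3 rs3 gs3 idx3.
have K0 : (0 < C * K)%N by rewrite muln_gt0 C0 /K Kk expn_gt0.
have lqQ : (lq <= Q)%N by rewrite /Q mul2n -addnn -addnA leq_addr.
have QS : Q = (2 * lq + 1).+1 by rewrite /Q addnS.
(* Both [n] and [m] are at most [2 ^ lq]; this is why the scale has about [2 * lq] levels. *)
have nm_q : (2 * (n * m) <= 2 ^ (2 * lq + 1))%N.
  rewrite expnD expn1 mulnC leq_pmul2r // mulnC expnM expnAC -mulnn.
  by apply: leq_mul; apply: leq_trans nmq; rewrite ?leq_addl ?leq_addr.
have parts : parts_spec delta K by exists l, k.
have optionsQ : options_spec Q by exists lq.
have b12 (c i : nat) : (c < m)%N -> (i < n)%N -> inc c i -> B c <= beta.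
  by move=> cm ilt; apply: beta1.
have [_ _ _ Q4 K4] := rs4.
have test : beval s4 (BNle (nvar v_options) (nscale C (nvar v_parts))) = (Q <= C * K)%N.
  by rewrite /= neval_nscale /= Q4 K4.
have [QK|KQ] := leqP Q (C * K).
  exists (t1 + (t2 + (t3 + (t4 + 2))))%N, s4, K, Q; split.
  - do 4!(apply: exec_seq; first eassumption).
    by apply: exec_if; rewrite test QK; constructor.
  - by case: gs4.
  - by case: gs4.
  - by case: gs4.
  split=> //.
    move=> _ y y0; have [best0 _ _] := gs4.
    apply: le_trans (total_pay_uniform_le r W beta (2 * lq + 1) n m inc B beta0 B0 BW W0 b12 beta2
      nm_q _ best0 _ y y0) _.
      by move=> j jq; apply: gain4; rewrite QS.
    by rewrite -QS ler_wpM2r // ler_nat leq_add2r leq_mul2l.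
  left; rewrite /prep_time; move: T1 T2 T3 T4; rewrite /options_time.
  have := lqQ; clearbody Q; clear; move: (uniform_time _ _ _) => U.
  by move: (D * n * 3)%N (m * _)%N => X Y; lia.
have [[n4 _ _ _] _ _ _ _] := rs4.
have [t5 [s5 [e5 T5 [g [sz5 ng ng0 gn gmin]]]]] := runs_size n s4 C K K0 n4 K4.
have fs5 := exec_frame e5.
have rs5 := ready_frame fs5 rs4 isT isT.
have gs5 := good_frame fs5 gs4 isT isT.
have idx5 i : nmem s5 v_option i = 0%N by case: fs5 => -> .
have ng0' : ((0 < n) ==> (0 < g))%N by apply/implyP.
have [t6 [s6 [e6 T6 [gs6 [G' GG [nG' best6 gain6]]]]]] :=
  runs_groups r n m inc B W beta Q K W0 beta0 betaW g (C * K) s5 ng0' ng rs5 gs5 idx5 sz5.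
exists (t1 + (t2 + (t3 + (t4 + (t5 + t6).+1))))%N, s6, K, Q; split.
- do 4!(apply: exec_seq; first eassumption).
  by apply: exec_if; rewrite test leqNgt KQ; apply: exec_seq e6.
- by case: gs6.
- by case: gs6.
- by case: gs6.
split=> //.
  move=> n_0 y y0; have [best0 _ _] := gs6.
  apply: le_trans (total_pay_grouped_le r W beta (2 * lq + 1) n m inc B beta0 B0 BW W0 b12 beta2
    nm_q _ best0 _ g G' y y0 (ng0 n_0) _ _) _.
  - move=> j jq; apply: le_trans best6; case: fs5 => _ -> //.
    by apply: gain4; rewrite QS.
  - by move=> i ilt; rewrite ltn_divLR ?ng0 //; apply: leq_trans nG'.
  - by move=> t f tG fQ; apply: gain6 => // x; rewrite QS.
  by rewrite ler_wpM2r // ler_nat leq_add2r leq_mul2l GG orbT.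
right; exists g; split=> //.
rewrite /prep_time /search_time; move: T1 T2 T3 T4 T5 T6; rewrite /options_time.
have := lqQ.
set X := (C * K)%N; set Y := group_time _ _ _ _.
have -> : (Y + 1).+1 = (Y + 2)%N by rewrite addn1 addn2.
set Z := (X * _)%N; set U := uniform_time _ _ _; clearbody Q X Y Z U; clear; lia.
Qed.

End ProgramCorrect.

(** * Revenue of an instance *)

Section Instances.
Context {R : realType}.
Variables (k n m : nat) (I : instance R k n m).

Definition incident (c i : nat) := [exists c' : 'I_m, exists i' : 'I_n,
  [&& c' == c :> nat, i' == i :> nat & i' \in bundle I c']].

Definition budget_at (c : nat) : R := if insub c is Some c' then budget I c' else 0.

Lemma incidentE (c : 'I_m) (i : 'I_n) : incident c i = (i \in bundle I c).
Proof.
apply/existsP/idP => [[c' /existsP[i' /and3P[/eqP/val_inj-> /eqP/val_inj->]]]|ici] //.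
by exists c; apply/existsP; exists i; rewrite !eqxx.
Qed.

Lemma budget_atE (c : 'I_m) : budget_at c = budget I c.
Proof. by rewrite /budget_at valK. Qed.

Lemma budget_at_ge0 c : 0 <= budget_at c.
Proof. by rewrite /budget_at; case: insubP => // c' _ _; apply: budget_ge0. Qed.

Lemma input_init delta : input n m incident budget_at (init delta I).
Proof.
split=> // c i cm ilt /=; rewrite lt0b.
apply/existsP/existsP => -[c' /existsP[i' h]]; exists c'; apply/existsP; exists i'.
  case/andP: h => /eqP e ->; rewrite andbT.
  (* Division by [n] recovers the row and the column from the cell index. *)
  have n0 : (0 < n)%N by apply: leq_ltn_trans ilt.
  have := congr1 (divn^~ n) e; rewrite !divnMDl // !divn_small // !addn0 => ec.
  by move: e; rewrite ec => /eqP; rewrite eqn_add2l => /eqP->; rewrite !eqxx.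
by case/and3P: h => /eqP<- /eqP<- ->; rewrite eqxx.
Qed.

Variable W : R.
Hypothesis BW : forall c, budget I c < W.

Lemma cap_ge0 (c : 'I_m) : 0 <= W.
Proof. by apply: le_trans (budget_ge0 I c) (ltW (BW c)). Qed.

(* Capping a price at [W] changes no payment, since every budget is below [W]. *)
Definition capped (p : 'I_n -> \bar R) (i : nat) : R :=
  if insub i is Some i' then fine (Order.min (p i') W%:E) else 0.

Lemma cappedE p (i : 'I_n) : is_price p -> 0 <= W ->
  (capped p i)%:E = Order.min (p i) W%:E.
Proof.
move=> p0 W0; rewrite /capped valK fineK // ge0_fin_numE.
  by rewrite gt_min ltry orbT.
by rewrite le_min p0 lee_fin.
Qed.

Lemma capped_ge0 p i : is_price p -> 0 <= W -> 0 <= capped p i.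
Proof.
move=> p0 W0; rewrite /capped; case: insubP => // i' _ _.
by apply: fine_ge0; rewrite le_min p0 lee_fin.
Qed.

(** Under UDP, capping commutes with the minimum, and [W] is as unaffordable as infinity. Under SMP,
    a price above [W] makes the bundle unaffordable before and after capping; otherwise no price in
    the bundle changes. *)
Lemma payment_capped r (p : 'I_n -> \bar R) (c : 'I_m) : is_price p ->
  payment r I p c =
  (pay r (off_price r W) (incident c) (budget I c) (capped p) n)%:E.
Proof.
move=> p0; rewrite /payment /pay; set S := bundle I c; set b := budget I c.
have bW : b < W by exact: BW.
have W0 := cap_ge0 c.
case: r => /=.
  set X := \big[_/_]_(_ in _) _; set a := ask _ _ _ _ _.
  have Xa : a%:E = Order.min X W%:E.
    apply/eqP; rewrite eq_le; apply/andP; split.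
      rewrite le_min lee_fin ask_UDP_le_off andbT.
      apply/bigmin_geP; split; first exact: leey.
      move=> i iS; apply: (@le_trans _ _ (capped p i)%:E).
        by rewrite lee_fin; apply: ask_UDP_le => //; rewrite incidentE.
      by rewrite cappedE // ge_min lexx.
    have [e|[i [ilt ici e]]] := ask_UDP_attained W (incident c) (capped p) n; rewrite /a e.
      by rewrite ge_min lexx orbT.
    move: ici; rewrite -[i]/(val (Ordinal ilt)) incidentE => iS.
    rewrite cappedE // le_min; apply/andP; split.
      by rewrite ge_min (bigmin_le_cond _ _ iS).
    by rewrite ge_min lexx orbT.
  have Xb : (X <= b%:E)%E = (a <= b).
    by rewrite -lee_fin Xa ge_min [(W%:E <= _)%E]leNgt lte_fin bW orbF.
  rewrite Xb; case: ifP => // ab; rewrite Xa min_l //.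
  by apply: (@le_trans _ _ b%:E); rewrite ?Xb // lee_fin ltW.
rewrite ask_SMP add0r big_mkord.
have -> : \sum_(i < n | incident c i) capped p i = \sum_(i in S) capped p i.
  by apply: eq_bigl => i; rewrite incidentE.
have [big|small] := pselect (exists2 i, i \in S & (W%:E < p i)%E).
  have [i iS Wp] := big.
  rewrite ifF.
    rewrite ifF //; apply/negbTE; rewrite -ltNge; apply: lt_le_trans bW _.
    rewrite (bigD1 i) //=; have <- : capped p i = W.
      by apply: EFin_inj; rewrite cappedE // min_r // ltW.
    by rewrite lerDl; apply: sumr_ge0 => j _; apply: capped_ge0.
  apply/negbTE; rewrite -ltNge; apply: (@lt_trans _ _ W%:E); first by rewrite lte_fin.
  apply: lt_le_trans Wp _; rewrite (bigD1 i) //=.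
  by rewrite leeDl // sume_ge0.
have -> : (\sum_(i in S) p i = (\sum_(i in S) capped p i)%:E)%E.
  rewrite -sumEFin; apply: eq_bigr => i iS; rewrite cappedE // min_l //.
  by rewrite leNgt; apply/negP => Wp; apply: small; exists i.
by rewrite lee_fin; case: ifP.
Qed.

Lemma revenue_capped r (p : 'I_n -> \bar R) : is_price p ->
  revenue r I p =
  (total_pay r (off_price r W) n m incident budget_at (capped p))%:E.
Proof.
move=> p0; rewrite /revenue /total_pay big_mkord -sumEFin.
by apply: eq_bigr => c _; rewrite payment_capped // budget_atE.
Qed.

End Instances.

(** * The running time *)

Lemma options_le n m Q : options_spec n m Q -> (Q <= 2 * (n + m).+1)%N.
Proof.
move=> [l [-> _ lnm]]; suff : (l <= n + m)%N by lia.
case: l lnm => //= l; rewrite expnS ltn_pmul2l // => lt.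
exact: leq_trans (ltn_expl l (isT : 1 < 2)%N) (ltnW lt).
Qed.

Section RunningTime.
Context {R : realType}.
Variable delta : R.
Hypothesis delta0 : 0 < delta.

Let ln2_gt0 : 0 < ln (2 : R). Proof. by rewrite ln_gt0 // ltr1n. Qed.

Lemma powR2_log2 (x : R) : 0 < x -> 2 `^ log2 x = x.
Proof.
move=> x0; rewrite /powR pnatr_eq0 /= /log2 divfK ?gt_eqF // lnK //.
Qed.

Lemma log2_nat_ge1 m : (1 < m)%N -> 1 <= log2 (m%:R : R).
Proof.
move=> m1; rewrite /log2 ler_pdivlMr // mul1r ler_ln ?posrE ?ltr0n // ?ler_nat //.
exact: ltnW.
Qed.

Lemma log2_nat_ge0 m : 0 <= log2 (m%:R : R).
Proof.
case: m => [|m]; first by rewrite /log2 ln0 // mul0r.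
by rewrite /log2 divr_ge0 ?ln_ge0 ?ler1n ?(ltW ln2_gt0).
Qed.

Lemma time_factor_ge1 m : 1 <= time_factor delta m.
Proof.
rewrite /time_factor -{1}(powRr0 2) ler_powR ?ler1n //.
have [m1|m1] := leqP m 1.
  have -> : log2 (m%:R : R) = 0.
    rewrite /log2; case: m m1 => [|[|]] // _; first by rewrite ln0 // mul0r.
    by rewrite (_ : 1%:R = 1) // ln1 mul0r.
  by rewrite [log2 0]/log2 ln0 // mul0r mulr0.
by rewrite mulr_ge0 ?powR_ge0 // /log2 divr_ge0 ?(ltW ln2_gt0) // ln_ge0 // log2_nat_ge1.
Qed.

(** The form in which the time factor meets a bound on [Q.+1 ^ g]: a power with base [log2 m]. *)
Lemma time_factorE m : 0 < log2 (m%:R : R) ->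
  time_factor delta m = log2 m%:R `^ (log2 m%:R `^ ((1 - delta) / delta)).
Proof. by move=> l0; rewrite /time_factor mulrC powRrM powR2_log2. Qed.

Lemma parts_le n K : (0 < n)%N -> parts_spec n delta K -> K%:R <= (n%:R : R) `^ delta.
Proof.
move=> n0 [l [k [-> ln _ /andP[kl _]]]].
have ln' : (2 ^+ l : R) <= n%:R by rewrite -natrX ler_nat ln.
rewrite natrX -powR_mulrn //.
apply: (@le_trans _ _ ((2 ^+ l) `^ delta)); last first.
  by apply: ge0_ler_powR; rewrite ?nnegrE ?exprn_ge0 // ltW.
by rewrite -[X in _ <= X `^ _]powR_mulrn // -powRrM mulrC ler_powR // ler1n.
Qed.

(** Both floors in the exponent of [K] are paid for here: the one of [log2 n] costs [2 ^ delta], the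
    outer one a factor 2. *)
Lemma le_parts n K : parts_spec n delta K ->
  (n%:R : R) `^ delta <= 2 `^ (1 + delta) * K%:R.
Proof.
move=> [l [k [-> _ nl /andP[_ lk]]]].
have nl' : n%:R <= (2 ^+ l.+1 : R) by rewrite -natrX ler_nat ltnW.
apply: (@le_trans _ _ ((2 ^+ l.+1) `^ delta)).
  by apply: ge0_ler_powR; rewrite ?nnegrE ?exprn_ge0 // ltW.
rewrite -powR_mulrn // -powRrM natrX -powR_mulrn // -powRD; last by rewrite pnatr_eq0 implybT.
rewrite ler_powR ?ler1n // -!natr1 mulrDl mul1r.
by move: lk; rewrite -natr1; lra.
Qed.

(** For positive [m], minimality of [l] gives [2 ^ l < 2 * (n + m) <= 4 * n * m]. For [m = 0] the
    convention [ln 0 = 0] makes the last term vanish. *)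
Lemma options_log n m Q : (0 < n)%N -> options_spec n m Q ->
  Q%:R <= 6 + 2 * log2 (n%:R : R) + 2 * log2 (m%:R : R).
Proof.
move=> n0 [l [-> _ lnm]].
suff : l%:R <= 2 + log2 (n%:R : R) + log2 (m%:R : R) by rewrite natrD natrM; lra.
case/orP: lnm => [/eqP->|lt].
  by have := log2_nat_ge0 n; have := log2_nat_ge0 m; lra.
have -> : l%:R = log2 (2 ^+ l : R).
  by rewrite /log2 lnXn // -[ln 2 *+ l]mulr_natl mulfK ?gt_eqF.
have log2_4 : log2 (4 : R) = 2.
  rewrite /log2 -[4]/((2 * 2)%:R) natrM lnM ?posrE // -mulr2n -[X in X / _]mulr_natl.
  by rewrite mulfK ?gt_eqF.
rewrite -[X in _ <= X + _ + _]log2_4.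
have [m0|m0] := posnP m.
  have log2_0 : log2 (0%:R : R) = 0 by rewrite /log2 ln0 // mul0r.
  rewrite m0 log2_0 addr0 /log2 -mulrDl -lnM ?posrE ?ltr0n //.
  rewrite ler_pM2r ?invr_gt0 // ler_ln ?posrE ?exprn_gt0 ?mulr_gt0 ?ltr0n //.
  by rewrite -natrX -natrM ler_nat; move: lt; rewrite m0; lia.
rewrite /log2 -!mulrDl -!lnM ?posrE ?mulr_gt0 ?ltr0n //.
rewrite ler_pM2r ?invr_gt0 // ler_ln ?posrE ?exprn_gt0 ?mulr_gt0 ?ltr0n //.
rewrite -natrX -!natrM ler_nat; apply: leq_trans (ltnW lt) _.
by move: n0 m0; clear; nia.
Qed.

(** Each summand serves one estimate of the search space: 24 absorbs the additive constant in [Q]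
    and makes [log2 m] at least 3, the second bounds [g] and [n^delta], and the third makes [log2 n]
    small against [Q]. *)
Definition group_factor : nat :=
  (Num.truncn (24 + 10 * 2 `^ (1 + delta) + 4 * 2 `^ (1 + delta) / (delta * ln 2) : R)).+1.

(** The search happens only if [Q] exceeds [C * K], hence a multiple of [n^delta]. As [Q] is
    logarithmic in [n] and [m], this forces [log2 m] to dominate [n^delta], so a bound in terms of
    [n^(1-delta)] becomes one in terms of [log2 m]. *)
Lemma search_space_le n m K Q g : (0 < n)%N ->
  parts_spec n delta K -> options_spec n m Q ->
  (group_factor * K < Q)%N -> (g.-1 * (group_factor * K) < n \/ g = 0)%N ->
  (Q.+1 ^ g)%:R <= Q.+1%:R * time_factor delta m.
Proof.
move=> n0 Kspec Qspec KQ gmin.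
have TF1 := time_factor_ge1 m.
have [g1|g1] := leqP g 1.
  apply: (@le_trans _ _ Q.+1%:R); last by rewrite ler_peMr.
  by rewrite ler_nat -[leqRHS]expn1 leq_pexp2l.
have {}gmin : (g.-1 * (group_factor * K) < n)%N by case: gmin g1 => // ->.
have g_double : (g <= 2 * g.-1)%N by move: g1; clear; lia.
set E : R := 2 `^ (1 + delta); have E0 : 0 < E by rewrite powR_gt0.
set C := group_factor in KQ gmin *.
have Cge : 24 + 10 * E + 4 * E / (delta * ln 2) <= C%:R.
  by apply/ltW/truncnS_gt.
have Y0 : 0 <= 4 * E / (delta * ln 2).
  by rewrite divr_ge0 ?mulr_ge0 // ltW // mulr_gt0.
have C10 : 10 * E <= C%:R by lra.
have C24 : 24 <= C%:R :> R by lra.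
have CE : 4 * E <= C%:R * (delta * ln 2).
  by rewrite -ler_pdivrMr ?mulr_gt0 //; lra.
set N : R := n%:R `^ delta; set P : R := n%:R `^ (1 - delta).
have NK : N <= E * K%:R := le_parts n K Kspec.
have n0' : 0 < n%:R :> R by rewrite ltr0n.
have N0 : 0 < N by rewrite powR_gt0.
have P0 : 0 < P by rewrite powR_gt0.
have nNP : n%:R = N * P.
  rewrite /N /P -powRD; last by apply/implyP => _; rewrite gt_eqF.
  by rewrite addrC subrK powRr1.
have K1 : 1 <= K%:R :> R.
  by case: Kspec => l [k [-> _ _ _]]; rewrite ler1n expn_gt0.
have KQ' : C%:R * K%:R < Q%:R :> R by rewrite -natrM ltr_nat.
have gCK : g%:R * (C%:R * K%:R) <= 2 * n%:R :> R.
  rewrite -!natrM ler_nat; apply: (@leq_trans (2 * (g.-1 * (C * K)))).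
    by rewrite [leqRHS]mulnA leq_mul2r g_double orbT.
  by rewrite leq_mul2l ltnW.
have gP : 5 * g%:R <= P.
  have h1 : g%:R * C%:R * N <= 2 * E * P * N.
    apply: (@le_trans _ _ (E * (g%:R * (C%:R * K%:R)))).
      rewrite (_ : E * _ = g%:R * C%:R * (E * K%:R)); last by ring.
      by rewrite ler_wpM2l // mulr_ge0.
    rewrite (_ : 2 * E * P * N = E * (2 * (N * P))); last by ring.
    by rewrite -nNP ler_pM2l.
  rewrite ler_pM2r // in h1.
  have h2 : g%:R * (10 * E) <= 2 * E * P by apply: le_trans h1; rewrite ler_wpM2l.
  have : (2 * E) * (5 * g%:R) <= (2 * E) * P by move: h2; lra.
  by rewrite ler_pM2l // mulr_gt0.
(* For [delta >= 1] one would have [P <= 1], against [5 * g <= P]; so groups of at least two items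
   occur only for [delta < 1]. *)
have g2 : 2 <= g%:R :> R by rewrite ler_nat.
have d1 : delta < 1.
  rewrite ltNge; apply/negP => d1.
  have : P <= n%:R `^ 0 by rewrite ler_powR ?ler1n //; lra.
  by rewrite powRr0; lra.
set ell : R := log2 m%:R.
have Qlog := options_log n m Q n0 Qspec.
have logn : 4 * log2 (n%:R : R) <= Q%:R.
  (* This is [ln N <= N - 1] for [N = n^delta]. *)
  have lnN : delta * ln n%:R <= N.
    rewrite -ln_powR; have := @le_ln1Dx R (N - 1).
    by rewrite addrCA subrr addr0 -/N; lra.
  have : 4 * log2 (n%:R : R) * (delta * ln 2) <= Q%:R * (delta * ln 2).
    have -> : 4 * log2 (n%:R : R) * (delta * ln 2) = 4 * (delta * ln n%:R).
      by rewrite /log2; field; rewrite gt_eqF.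
    apply: (@le_trans _ _ (4 * (E * K%:R))); first by rewrite ler_pM2l //; lra.
    rewrite mulrA; apply: (@le_trans _ _ (C%:R * (delta * ln 2) * K%:R)).
      by rewrite ler_wpM2r.
    by rewrite mulrAC ler_pM2r ?mulr_gt0 // ltW.
  by rewrite ler_pM2r // mulr_gt0.
have CCK : C%:R <= C%:R * K%:R :> R by rewrite ler_peMr.
(* In [Q <= 6 + 2 * log2 n + 2 * ell] the first term is at most [Q / 4] because [24 < Q], and the
   second at most [Q / 2]. *)
have Qell : Q%:R <= 8 * ell by move: Qlog; rewrite -/ell; lra.
have ell3 : 3 <= ell by lra.
have Q1 : Q.+1%:R <= ell `^ 3.
  rewrite -[3]/(3%:R) powR_mulrn; last by lra.
  apply: (@le_trans _ _ (9 * ell)); first by rewrite -natr1; lra.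
  rewrite exprSr ler_pM2r; last by lra.
  by rewrite -[9]/((3 * 3)%:R) natrM expr2 ler_pM.
have Nell : N <= ell.
  have : 10 * E * K%:R <= C%:R * K%:R by rewrite ler_wpM2r.
  by move: NK; set EK := E * K%:R; rewrite -mulrA -/EK; lra.
have PX : P <= ell `^ ((1 - delta) / delta).
  have -> : P = N `^ ((1 - delta) / delta).
    by rewrite /N /P -powRrM mulrCA divff ?gt_eqF // mulr1.
  have ell0 : 0 <= ell by lra.
  have e0 : 0 <= (1 - delta) / delta by rewrite divr_ge0 ?subr_ge0 // ltW.
  by apply: ge0_ler_powR; rewrite ?nnegrE // ltW.
rewrite natrX time_factorE; last by rewrite -/ell; lra.
apply: (@le_trans _ _ (ell `^ (ell `^ ((1 - delta) / delta)))); last first.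
  by rewrite -/ell ler_peMl ?powR_ge0 // ler1n.
(* The exponent becomes [3 * g <= P <= ell^((1-delta)/delta)]. *)
apply: (@le_trans _ _ ((ell `^ 3) `^ g%:R)).
  by rewrite [leRHS]powR_mulrn ?powR_ge0 // lerXn2r // nnegrE ?powR_ge0.
by rewrite -powRrM ler_powR; lra.
Qed.

End RunningTime.

(** * Polynomial bounds on the step counts *)

Lemma try_time_le n m : (try_time n m <= 25 * (n + m).+1 ^ 2)%N.
Proof.
rewrite /try_time; set N := (n + m).+1.
have nN : (n <= N)%N by rewrite /N; lia.
have mN : (m <= N)%N by rewrite /N; lia.
have N1 : (0 < N)%N by [].
have := leq_mul mN nN; have := leq_mul N1 N1; have := leq_mul nN N1; have := leq_mul mN N1.
clearbody N; rewrite -mulnn; clear; nia.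
Qed.

Lemma prep_time_le n m D Q : (Q <= 2 * (n + m).+1)%N ->
  (prep_time n m D Q <= (300 + 3 * D) * (n + m).+1 ^ 3)%N.
Proof.
rewrite /prep_time /uniform_time; have := try_time_le n m.
set N := (n + m).+1; set T := try_time n m => TN QN.
have nN : (n <= N)%N by rewrite /N; lia.
have mN : (m <= N)%N by rewrite /N; lia.
have N1 : (1 <= N)%N by [].
have N2 : (N <= N ^ 2)%N by rewrite -mulnn leq_pmull.
have N3 : (N ^ 2 <= N ^ 3)%N by rewrite [(N ^ 3)%N]expnS leq_pmull.
have mn : (m * (n * 5 + 5) <= 10 * N ^ 2)%N.
  apply: (@leq_trans (N * (10 * N))); first by apply: leq_mul => //; lia.
  by rewrite mulnCA mulnn.
have QT : (Q * ((n * 3).+2 + T).+2 <= 2 * N * (32 * N ^ 2))%N.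
  by apply: leq_mul => //; lia.
have QT' : (2 * N * (32 * N ^ 2) = 64 * N ^ 3)%N by rewrite mulnACA -expnS.
have Dn : (D * n <= D * N ^ 3)%N by rewrite leq_mul2l; apply/orP; right; lia.
rewrite mulnDl -mulnA; move: mn QT QT' Dn nN mN N1 N2 N3 QN.
by clear; lia.
Qed.

Lemma search_time_le n m CK Q g :
  (Q <= 2 * (n + m).+1)%N -> (CK < Q)%N -> (g <= n)%N ->
  (search_time n m CK Q g <= 100 * (n + m).+1 ^ 3 * Q.+1 ^ g)%N.
Proof.
rewrite /search_time /group_time; have := try_time_le n m.
set N := (n + m).+1; set T := try_time n m; set Z := (Q.+1 ^ g)%N => TN QN CKQ gn.
have nN : (n <= N)%N by rewrite /N; lia.
have N1 : (1 <= N)%N by [].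
have Z1 : (1 <= Z)%N by rewrite expn_gt0.
have N2 : (N <= N ^ 2)%N by rewrite -mulnn leq_pmull.
have N3 : (N ^ 2 <= N ^ 3)%N by rewrite [(N ^ 3)%N]expnS leq_pmull.
have N2Z : (N ^ 2 <= N ^ 2 * Z)%N by rewrite leq_pmulr.
have N3Z : (N ^ 3 <= N ^ 3 * Z)%N by rewrite leq_pmulr.
have ZT : (Z * (T + (1 + (g * 6).+2)).+1 <= 35 * (N ^ 2 * Z))%N.
  rewrite mulnC mulnA; apply: leq_mul => //; lia.
have CKT : (CK * (1 + (Z * (T + (1 + (g * 6).+2)).+1).+1 + 2) <=
    2 * N * (39 * (N ^ 2 * Z)))%N by apply: leq_mul; lia.
have E : (2 * N * (39 * (N ^ 2 * Z)) = 78 * (N ^ 3 * Z))%N.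
  by rewrite mulnACA [(N * _)%N]mulnA -expnS.
rewrite -mulnA; move: CKT E nN N1 N2 N3 N3Z; clear; lia.
Qed.

Lemma running_time_le {R : realType} (delta : R) n m D K Q t : 0 < delta ->
  parts_spec n delta K -> options_spec n m Q ->
  (t <= prep_time n m D Q)%N \/
  (exists g, [/\ (group_factor delta * K < Q)%N, (g <= n)%N,
    (g.-1 * (group_factor delta * K) < n \/ g = 0)%N &
    (t <= prep_time n m D Q + search_time n m (group_factor delta * K) Q g)%N]) ->
  t%:R <= (600 + 3 * D)%:R * (time_factor delta m * (n + m).+1%:R ^+ 4).
Proof.
have -> : (600 + 3 * D)%N = ((300 + 3 * D) + 300)%N by lia.
move=> delta0 Kspec Qspec; have QN := options_le _ _ _ Qspec.
have TF1 := time_factor_ge1 delta m; have := prep_time_le n m D Q QN.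
move: (300 + 3 * D)%N => c.
set N := (n + m).+1 in QN *; set TF := time_factor delta m in TF1 *.
move: (prep_time _ _ _ _) => p pN tcase.
have N34 : (N ^ 3 <= N ^ 4)%N by rewrite [(N ^ 4)%N]expnS leq_pmull.
have N4_0 : 0 <= N%:R ^+ 4 :> R by rewrite exprn_ge0.
suff [x xTF tx] : exists2 x : R, x <= 300 * TF * N%:R ^+ 4 & t%:R <= p%:R + x.
  apply: le_trans tx _; apply: (@le_trans _ _ (c%:R * (TF * N%:R ^+ 4) + x)).
    rewrite lerD2r; apply: (@le_trans _ _ ((c * N ^ 4)%:R)).
      by rewrite ler_nat; apply: leq_trans pN _; rewrite leq_mul2l N34 orbT.
    by rewrite natrM natrX ler_wpM2l // ler_peMl.
  by rewrite natrD [leRHS]mulrDl lerD2l [leRHS]mulrA.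
case: tcase => [tp|[g [KQ gn gmin tp]]].
  exists 0; first by apply: mulr_ge0 N4_0; apply: mulr_ge0 (ler0n _ _) (le_trans ler01 TF1).
  by rewrite addr0 ler_nat.
exists (search_time n m (group_factor delta * K) Q g)%:R; last by rewrite -natrD ler_nat.
have sT := search_time_le n m _ Q g QN KQ gn.
apply: (@le_trans _ _ ((100 * N ^ 3 * Q.+1 ^ g)%:R)); first by rewrite ler_nat.
rewrite natrM.
have Z : (Q.+1 ^ g)%:R <= 3 * N%:R * TF.
  have QN' : Q.+1%:R <= 3 * N%:R :> R by rewrite -natrM ler_nat; lia.
  (* Without items, [g <= n] leaves a single empty price vector. *)
  have [n0|n0] := posnP n; last first.
    apply: le_trans (search_space_le delta delta0 n m K Q g n0 Kspec Qspec KQ gmin) _.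
    by rewrite ler_wpM2r // (le_trans ler01).
  move: gn; rewrite n0 leqn0 => /eqP->; rewrite expn0.
  have N1 : 1 <= N%:R :> R by rewrite ler1n.
  by rewrite -[X in X <= _]mulr1 ler_pM //; lra.
apply: le_trans (ler_wpM2l _ Z) _; first by [].
by rewrite natrM natrX exprSr le_eqVlt; apply/orP; left; apply/eqP; ring.
Qed.

Theorem theorem1p4 (R : realType) (rule : buying_rule) (delta : R)
    (hdelta : 0 < delta) :
  exists (P : cmd) (A C : R) (d : nat),
    [/\ 0 < A, 0 < C &
      forall (k n m : nat) (I : instance R k n m),
      exists (t : nat) (s : state R),
        [/\ exec P (init delta I) t s,
            is_price (output (n := n) s),
            approximates rule I (output s) (A * n%:R `^ delta) &
            t%:R <= C * (time_factor delta m * (n + m).+1%:R ^+ d)]].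
Proof.
pose D := (Num.truncn delta).+1; pose C := group_factor delta.
have dD : delta <= D%:R by apply/ltW/truncnS_gt.
(* The program text depends on [delta] only through the natural number [C]. The factor [3 * C]
   covers [2 * (C * K) + 1], since [K <= n^delta] and [1 <= C * n^delta]. *)
exists (program rule C), (3 * C)%:R, (600 + 3 * D)%:R, 4%N.
split; rewrite ?ltr0n //.
move=> k n m I.
have [||||t [s [K [Q [es out_bounds best0 best_le [opt_le Kspec Qspec time]]]]]] :=
  program_correct rule n m (incident k n m I) (budget_at k n m I) (init delta I)
    delta D C (ltn0Sn _) hdelta dD (input_init k n m I delta).
- exact: budget_at_ge0.
- by [].
- by move=> [|[|a]] j.
- by move=> [|[|[|a]]] j.
set W := 1 + _ in out_bounds best_le opt_le.
have B0 := budget_at_ge0 k n m I.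
have W0 : 0 <= W by rewrite addr_ge0 ?sumr_ge0.
have BW c : budget I c < W.
  rewrite -budget_atE /W (bigD1_seq (val c)) ?iota_uniq ?mem_index_iota ?ltn_ord //=.
  have : 0 <= \sum_(0 <= i < m | i != val c) budget_at k n m I i by apply: sumr_ge0.
  lra.
(* The array of infinity flags is never written: all output prices are finite. *)
have outE i : output s i = (rmem s 2 i)%:E.
  by rewrite /output; case: (exec_frame es) => ->.
have priceo : is_price (output (n := n) s).
  by move=> i; rewrite outE lee_fin; have /andP[] := out_bounds i (ltn_ord i).
exists t, s; split=> //; last exact: running_time_le Kspec Qspec time.
have rev_out : ((rmem s 3 0)%:E <= revenue rule I (output s))%E.
  rewrite (revenue_capped k n m I W BW) // lee_fin; apply: le_trans best_le _.
  rewrite le_eqVlt; apply/orP; left; apply/eqP/eq_total_pay => i ilt.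
  apply: EFin_inj; rewrite -[i]/(val (Ordinal ilt)) cappedE // outE min_l //.
  by rewrite lee_fin; have /andP[] := out_bounds i ilt.
(* For [n = 0] the ratio is 0 and so is its inverse, which leaves only nonnegativity of the
   revenue. *)
rewrite /approximates; have [n0|n0] := posnP n.
  have -> : n%:R = 0 :> R by rewrite n0.
  rewrite powR0 ?gt_eqF // mulr0 invr0 mul0e.
  by apply: le_trans rev_out; rewrite lee_fin.
apply: le_trans rev_out.
set rho := _ * _.
have nd1 : 1 <= n%:R `^ delta.
  by rewrite -[X in X <= _](powRr0 n%:R) ler_powR ?ler1n // ltW.
have rho0 : 0 < rho by rewrite mulr_gt0 ?ltr0n // (lt_le_trans ltr01).
have opt : (OPT rule I <= (rho * rmem s 3 0)%:E)%E.
  apply: ge_ereal_sup => _ [p p0 <-].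
  rewrite (revenue_capped k n m I W BW) // lee_fin.
  apply: le_trans (opt_le n0 _ _) _; first by move=> i; apply: capped_ge0.
  rewrite ler_wpM2r //.
  have Kn := parts_le delta hdelta n K n0 Kspec.
  have C1 : 1 <= C%:R :> R by rewrite ler1n.
  rewrite /rho natrD !natrM.
  have CK : C%:R * K%:R <= C%:R * n%:R `^ delta by rewrite ler_pM2l //; lra.
  have Cn : 1 <= C%:R * n%:R `^ delta by rewrite -[X in X <= _]mulr1 ler_pM.
  lra.
apply: le_trans (lee_wpmul2l _ opt) _; first by rewrite lee_fin invr_ge0 ltW.
by rewrite -EFinM mulrA mulVf ?mul1r // gt_eqF.
Qed.
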